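(* It is decidable whether a finitely based avoidance set $C=\mathrm{Av}(B)$ of equivalence relations is well quasi-ordered under the consecutive embedding ordering; that is, there is an algorithm which, given as input a finite set $B$ of equivalence relations on finite linearly ordered sets, decides whether $\mathrm{Av}(B)$ is well quasi-ordered under the consecutive embedding ordering.
   Context: An equivalence relation here is a pair $(X,\rho)$ with $X$ a finite linearly ordered set (without loss of generality a finite subset of $\mathbb{N}$ with its natural order) and $\rho$ an equivalence relation on $X$. For $X=\{x_1<\dots<x_n\}$ and $Y=\{y_1<\dots<y_m\}$, a map $f:X\to Y$ is contiguous if there is $k$ with $f(x_i)=y_{k+i-1}$ for all $i\in\{1,\dots,n\}$. The consecutive embedding order: $(X,\rho)\le(Y,\sigma)$ iff there is a contiguous map $f:X\to Y$ such that $(x,y)\in\rho\Leftrightarrow(f(x),f(y))\in\sigma$ for all $x,y\in X$. Relations are isomorphic if such an $f$ exists which is a bijection; isomorphic relations are considered equal (so one may take the underlying set to be $[1,n]=\{1,\dots,n\}$), and this gives a poset. $\mathrm{Av}(B)$ is the set of equivalence relations $\sigma$ with $\rho\not\le\sigma$ for all $\rho\in B$. A poset is well quasi-ordered if it has no infinite antichains and no infinite descending chains. *)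

(* Defs.v *)
From HB Require Import structures.
From mathcomp Require Import all_boot all_order.

Set Implicit Arguments.
Unset Strict Implicit.
Unset Printing Implicit Defensive.

Import Order.TTheory.

(** * Equivalence relations on finite linear orders

    Isomorphic relations are identified, so the underlying linear order is
    taken to be ['I_n] (elements counted from 0); the empty order ['I_0] is
    allowed. *)

Definition is_equiv (n : nat) (rho : {set 'I_n * 'I_n}) : bool :=
  [&& [forall x, (x, x) \in rho],
      [forall x, forall y, ((x, y) \in rho) ==> ((y, x) \in rho)] &
      [forall x, forall y, forall z,
        ((x, y) \in rho) ==> ((y, z) \in rho) ==> ((x, z) \in rho)]].

Record eqvrel : Type := EqRel {
  eqvrel_val : {n : nat & {set 'I_n * 'I_n}};
  _ : is_equiv (tagged eqvrel_val)
}.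

HB.instance Definition _ := [isSub for eqvrel_val].
HB.instance Definition _ := [Choice of eqvrel by <:].

Definition len (r : eqvrel) : nat := tag (eqvrel_val r).
Definition rel_of (r : eqvrel) : {set 'I_(len r) * 'I_(len r)} :=
  tagged (eqvrel_val r).

Lemma rel_refl (r : eqvrel) x : (x, x) \in rel_of r.
Proof. by case: r x => -[n rho] h x; case/and3P: (h) => /forallP. Qed.

Lemma rel_sym (r : eqvrel) x y : (x, y) \in rel_of r -> (y, x) \in rel_of r.
Proof.
case: r x y => -[n rho] pr x y; case/and3P: (pr) => _ /forallP h _.
by move: (h x) => /forallP /(_ y) /implyP.
Qed.

Lemma rel_trans (r : eqvrel) x y z :
  (x, y) \in rel_of r -> (y, z) \in rel_of r -> (x, z) \in rel_of r.
Proof.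
case: r x y z => -[n rho] pr x y z xy yz; case/and3P: (pr) => _ _ /forallP h.
move: (h x) => /forallP /(_ y) /forallP /(_ z).
by move=> /implyP /(_ xy) /implyP /(_ yz).
Qed.

(** * The consecutive embedding order *)

Definition contiguous (n m : nat) (f : 'I_n -> 'I_m) : Prop :=
  exists k : nat, forall i, f i = k + i :> nat.

Definition cembeds (r s : eqvrel) : Prop :=
  exists2 f : 'I_(len r) -> 'I_(len s), contiguous f &
    forall x y, ((x, y) \in rel_of r) = ((f x, f y) \in rel_of s).

(* Boolean form of [cembeds]; the offset [k] may be bounded by [m]. *)
Definition contiguousb (n m : nat) (f : {ffun 'I_n -> 'I_m}) : bool :=
  [exists k : 'I_m.+1, forall i, f i == k + i :> nat].

Definition cle (r s : eqvrel) : bool :=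
  [exists f : {ffun 'I_(len r) -> 'I_(len s)}, contiguousb f &&
    [forall x, forall y,
      ((x, y) \in rel_of r) == ((f x, f y) \in rel_of s)]].

Lemma contiguousP (n m : nat) (f : {ffun 'I_n -> 'I_m}) :
  reflect (contiguous f) (contiguousb f).
Proof.
apply: (iffP existsP) => [[k /forallP hk]|[k hk]].
  by exists k => i; apply/eqP.
case: n f hk => [f _|n f hk]; first by exists ord0; apply/forallP => -[].
have lt_k : k < m.+1.
  by rewrite ltnS -[k]addn0 -(hk ord0) ltnW.
by exists (Ordinal lt_k); apply/forallP => i; apply/eqP/hk.
Qed.

Lemma cleP (r s : eqvrel) : reflect (cembeds r s) (cle r s).
Proof.
apply: (iffP existsP) => [[f /andP[/contiguousP cf /forallP hf]]|[f [k hk] hf]].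
  by exists f => // x y; move: (hf x) => /forallP /(_ y) /eqP.
exists (finfun f); apply/andP; split.
  by apply/contiguousP; exists k => i; rewrite ffunE.
by apply/forallP => x; apply/forallP => y; rewrite !ffunE hf.
Qed.

Lemma cle_refl : reflexive cle.
Proof. by move=> r; apply/cleP; exists id => //; exists 0. Qed.

Lemma cle_trans : transitive cle.
Proof.
move=> s r t /cleP[f [k hk] hf] /cleP[g [l hl] hg]; apply/cleP.
exists (g \o f) => [|x y]; last by rewrite hf hg.
by exists (l + k) => i; rewrite /= hl hk addnA.
Qed.

Lemma contiguous_le (n m : nat) (f : 'I_n -> 'I_m) : contiguous f -> n <= m.
Proof.
case=> k hk; rewrite -(card_ord n) -(card_ord m).
apply: (leq_card f) => i j eq_f; apply/val_inj/eqP.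
by rewrite /= -(eqn_add2l k) -!hk eq_f.
Qed.

Lemma cle_anti : antisymmetric cle.
Proof.
move=> r s /andP[/cleP[f cf hf] /cleP[g /contiguous_le le_sr _]].
have le_rs := contiguous_le cf.
case: r s f cf hf le_rs le_sr {g} => -[n rho] /= pr [[m sig] /= ps] f cf hf.
rewrite /len /= in f cf hf * => le_nm le_mn.
have eq_nm : n = m by apply/eqP; rewrite eqn_leq le_nm.
case: m / eq_nm sig ps f cf hf {le_nm le_mn} => sig ps f [k hk] hf.
have f_id i : f i = i.
  have n_gt0 : 0 < n := leq_ltn_trans (leq0n i) (ltn_ord i).
  have lt_n1 : n.-1 < n by rewrite prednK.
  have := ltn_ord (f (Ordinal lt_n1)).
  rewrite hk /= -[X in _ < X](prednK n_gt0) ltnS -[X in _ <= X]add0n.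
  by rewrite leq_add2r leqn0 => /eqP k0; apply/val_inj; rewrite /= hk k0.
apply/val_inj => /=; congr Tagged; apply/setP => -[x y].
by have := hf x y; rewrite !f_id.
Qed.

Fact cembed_display : Order.disp_t. Proof. exact: Order.Disp tt tt. Qed.

HB.instance Definition _ :=
  Order.Le_isPOrder.Build cembed_display eqvrel cle_refl cle_anti cle_trans.

(** * Avoidance sets and well quasi-order *)

Definition Av (B : seq eqvrel) : {pred eqvrel} :=
  [pred s | all (fun r => ~~ (r <= s)%O) B].

(* [wqo A]: the subposet [A] of [T] is well quasi-ordered.  Infinite antichains
   are given by sequences of pairwise incomparable (hence distinct) elements. *)
Definition wqo (d : Order.disp_t) (T : porderType d) (A : {pred T}) : Prop :=
  ~ (exists u : nat -> T, (forall i, u i \in A) /\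
       (forall i j, i != j -> (u i >< u j)%O)) /\
  ~ (exists u : nat -> T, (forall i, u i \in A) /\
       (forall i, (u i.+1 < u i)%O)).

(** * Algorithms: partial recursive functions

    Arities are not tracked: a program is run on a list of arguments, and
    [MProj i] is undefined on lists of length at most [i].
      - [MComp f gs] is composition of [f] with the list [gs];
      - [MRec f g] is primitive recursion on the first argument:
        [h (0, v) = f v] and [h (n+1, v) = g (n, h (n, v), v)];
      - [MMin f] sends [v] to the least [n] such that [f (n, v) = 0], all the
        previous values being defined (and nonzero). *)

Inductive murec : Type :=
| MZero
| MSucc
| MProj of nat
| MComp of murec & seq murec
| MRec of murec & murec
| MMin of murec.

Inductive meval : murec -> seq nat -> nat -> Prop :=
| meval_zero v : meval MZero v 0
| meval_succ x v : meval MSucc (x :: v) x.+1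
| meval_proj i v : i < size v -> meval (MProj i) v (nth 0 v i)
| meval_comp f gs v w y :
    size w = size gs ->
    (forall i, i < size gs -> meval (nth MZero gs i) v (nth 0 w i)) ->
    meval f w y -> meval (MComp f gs) v y
| meval_rec0 f g v y : meval f v y -> meval (MRec f g) (0 :: v) y
| meval_recS f g n v y z :
    meval (MRec f g) (n :: v) y -> meval g [:: n, y & v] z ->
    meval (MRec f g) (n.+1 :: v) z
| meval_min f v n (k : nat -> nat) :
    (forall i, i < n -> meval f (i :: v) (k i).+1) ->
    meval f (n :: v) 0 -> meval (MMin f) v n.

Lemma meval_det p v y z : meval p v y -> meval p v z -> y = z.
Proof.
move=> h; elim: h z => {p v y}.
- by move=> v z h; inversion h.
- by move=> x v z h; inversion h.
- by move=> i v _ z h; inversion h.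
- move=> f gs v w y sw _ IHgs _ IHf z h.
  inversion h as [| | |f' gs' v' w' y' sw' hgs' hf'| | |]; subst.
  apply: IHf; suff -> : w = w' by [].
  apply: (@eq_from_nth _ 0) => [|i lt_i]; first by rewrite sw sw'.
  by rewrite sw in lt_i; apply: IHgs => //; apply: hgs'.
- by move=> f g v y _ IH z h; inversion h; subst; apply: IH.
- move=> f g n v y z _ IHy _ IHz z' h.
  inversion h as [| | | | |f' g' n' v' y' z'' hy' hz'|]; subst.
  by apply: IHz; rewrite (IHy _ hy').
- move=> f v n k _ IHk _ IH0 m h.
  inversion h as [| | | | | |f' v' m' k' hk' h0']; subst.
  case: (ltngtP n m) => // [lt_nm|lt_mn].
    by have := IH0 _ (hk' _ lt_nm).
  by have := IHk _ lt_mn _ h0'.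
Qed.

(* [P] is decidable for inputs [x] presented by the number [enc x]: some
   partial recursive function is defined on every code [enc x], with value 1
   if [P x] holds and 0 otherwise. *)
Definition decidable_by_murec (I : Type) (enc : I -> nat) (P : I -> Prop) : Prop :=
  exists p : murec, forall x : I,
    exists2 b : bool, meval p [:: enc x] b & b <-> P x.

(** * Presenting a finite basis as a natural number

    A relation is written as the word whose [i]-th letter is the least element
    equivalent to [i]; words, and lists of codes of words, become numbers via
    the bijection [CodeSeq.code : seq nat -> nat]. *)

Definition eqvrel_word (r : eqvrel) : seq nat :=
  [seq find (fun j => (i, j) \in rel_of r) (enum 'I_(len r))
  | i <- enum 'I_(len r)].

Definition code_basis (B : seq eqvrel) : nat :=
  CodeSeq.code [seq CodeSeq.code (eqvrel_word r) | r <- B].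

Lemma size_eqvrel_word r : size (eqvrel_word r) = len r.
Proof. by rewrite size_map size_enum_ord. Qed.

Lemma eqvrel_wordE r (x y : 'I_(len r)) :
  ((x, y) \in rel_of r) = (nth 0 (eqvrel_word r) x == nth 0 (eqvrel_word r) y).
Proof.
have nthE (i : 'I_(len r)) : nth 0 (eqvrel_word r) i =
    find (fun j => (i, j) \in rel_of r) (enum 'I_(len r)).
  by rewrite (nth_map i) ?size_enum_ord // nth_ord_enum.
have has_i (i : 'I_(len r)) :
    has (fun j => (i, j) \in rel_of r) (enum 'I_(len r)).
  by apply/hasP; exists i; rewrite ?mem_enum ?rel_refl.
rewrite !nthE; apply/idP/eqP => [xy|eq_xy].
  apply: eq_find => j; apply/idP/idP; last exact: rel_trans.
  by apply: rel_trans; apply: rel_sym.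
have hx := nth_find x (has_i x); have hy := nth_find x (has_i y).
by rewrite -eq_xy in hy; apply: rel_trans hx (rel_sym hy).
Qed.

Lemma eqvrel_word_inj : injective eqvrel_word.
Proof.
move=> r s eq_w; have eq_d : len r = len s.
  by rewrite -!size_eqvrel_word eq_w.
have hr := @eqvrel_wordE r; have hs := @eqvrel_wordE s.
move: hr hs; rewrite eq_w; move: (eqvrel_word s) => w {eq_w}.
case: r s eq_d => -[n rho] /= pr [[m sig] /= ps]; rewrite /len /= => eq_nm.
case: m / eq_nm sig ps => sig ps hr hs.
apply/val_inj => /=; congr Tagged; apply/setP => -[x y].
by have := hr x y; rewrite -(hs x y).
Qed.

Lemma code_basis_inj : injective code_basis.
Proof.
move=> B C /(can_inj CodeSeq.codeK); apply: inj_map => r s.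
by move/(can_inj CodeSeq.codeK)/eqvrel_word_inj.
Qed.

(* Main.v *)
(** Only the links shorter than a constant [c] are visible to a finite basis, so
    [Av B] is governed by its windows of length [c] (up to the kernel of the
    word), and words sharing a window can be cut and glued there.  Repeating the
    piece between two equal windows produces an infinite antichain in two cases:
    - arbitrarily distant positions may be linked; equivalently, some long word
      of the class has singleton first and last letters, which can be pumped
      and then linked;
    - some word has two equal windows at distance [q] such that the local
      [q]-periodicity around them is broken both to the left and to the right.
    Otherwise all links are short, and every word is a periodic prefix and a
    periodic suffix around a middle part of bounded length; by Dickson's lemma
    two words of any infinite sequence are comparable.  Cutting also bounds the
    length of the shortest word of either kind, so that the criterion is a
    bounded search. *)

Require Import Defs.
From mathcomp Require Import all_boot all_order.
From mathcomp Require Import zify.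
From Stdlib Require Import Classical IndefiniteDescription.

Set Implicit Arguments.
Unset Strict Implicit.
Unset Printing Implicit Defensive.

(** * Words up to kernel, and gluing along equal windows *)

Definition same c (w : nat -> nat) i (u : nat -> nat) j :=
  forall x y, x < c -> y < c ->
    (w (i + x) == w (i + y)) = (u (j + x) == u (j + y)).

Definition occurs m u n w := exists2 k, k + m <= n & same m u 0 w k.

Lemma same_at c w i u j p q : same c w i u j ->
  i <= p < i + c -> i <= q < i + c ->
  (w p == w q) = (u (p - i + j) == u (q - i + j)).
Proof.
move=> h hp hq; have := h (p - i) (q - i).
have -> : i + (p - i) = p by lia.
have -> : i + (q - i) = q by lia.
by rewrite ![j + _]addnC; apply; lia.
Qed.

Lemma same_sym c w i u j : same c w i u j -> same c u j w i.
Proof. by move=> h x y hx hy; rewrite h. Qed.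

Lemma same_trans c u i v j w k :
  same c u i v j -> same c v j w k -> same c u i w k.
Proof. by move=> h1 h2 x y hx hy; rewrite h1 // h2. Qed.

Lemma same_sub c w i u j d m : same c w i u j -> d + m <= c ->
  same m w (i + d) u (j + d).
Proof. by move=> h hm x y hx hy; rewrite -!addnA; apply: h; lia. Qed.

Record local_class b (A : nat -> (nat -> nat) -> Prop) : Prop := LocalClass {
  local_occurs : forall m u n w, occurs m u n w -> A n w -> A m u;
  local_windows : forall n w, b <= n ->
    (forall k, k + b <= n -> A b (fun x => w (k + x))) -> A n w }.

Lemma local_cover b A n w n' w' : local_class b A -> A n w -> b <= n' ->
  (forall k, k + b <= n' -> exists2 k', k' + b <= n & same b w' k w k') ->
  A n' w'.
Proof.
move=> hA An bn' h; apply: (local_windows hA) => // k /h[k' hk' hs].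
by apply: (local_occurs hA) An; exists k'.
Qed.

(* Amalgamation of the prefix [0, i + c) of [w] with its suffix from [j], the
   windows at [i] and [j] being identified; letters of the suffix that do not
   meet the window at [j] become fresh, so that the two parts share no class
   outside the overlap. *)
Definition graft (w : nat -> nat) i j c v :=
  let s := [pred z | w (j + z) == v] in
  if has s (iota 0 c) then w (i + find s (iota 0 c))
  else (\max_(y < i + c) w y).+1 + v.

(** For [i < j] this cuts out the piece between the two windows, for [j < i] it repeats that
    piece. *)
Definition splice w i j c x :=
  if x < i + c then w x else graft w i j c (w (x - i + j)).

Lemma graft_cases w i j c v :
  (exists z, [/\ z < c, w (j + z) = v & graft w i j c v = w (i + z)]) \/
  (graft w i j c v = (\max_(y < i + c) w y).+1 + v /\
   forall z, z < c -> w (j + z) <> v).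
Proof.
rewrite /graft; case: ifPn => [hs|hn]; [left|right].
  have lt := hs; rewrite has_find size_iota in lt.
  exists (find [pred z | w (j + z) == v] (iota 0 c)); split=> //.
  by have /eqP := nth_find 0 hs; rewrite nth_iota.
split=> // z hz /eqP hv; case/negP: hn; apply/hasP; exists z => //.
by rewrite mem_iota.
Qed.

Lemma graft_bound w m y : y < m -> w y < (\max_(y < m) w y).+1.
Proof. by move=> hy; rewrite ltnS (bigmax_sup (Ordinal hy)). Qed.

(** Letters met in the window at [j] go to the window at [i], which has the same equalities; all
    others are shifted above every letter of the prefix. *)
Lemma graft_inj w i j c : same c w i w j -> injective (graft w i j c).
Proof.
move=> h v1 v2.
case: (graft_cases w i j c v1) => [[z1 [h1 e1 ->]]|[-> n1]];
case: (graft_cases w i j c v2) => [[z2 [h2 e2 ->]]|[-> n2]].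
- by move/eqP; rewrite h // e1 e2 => /eqP.
- by have := @graft_bound w (i + c) (i + z1); lia.
- by have := @graft_bound w (i + c) (i + z2); lia.
- by lia.
Qed.

Lemma splice_left w i j c p : p < i + c -> splice w i j c p = w p.
Proof. by rewrite /splice => ->. Qed.

Lemma splice_right w i j c p q : same c w i w j -> i <= p -> i <= q ->
  (splice w i j c p == splice w i j c q) = (w (p - i + j) == w (q - i + j)).
Proof.
move=> h hp hq; have E r : i <= r ->
    splice w i j c r = graft w i j c (w (r - i + j)).
  (* On the overlap, the prefix letter is already the [graft] of the matching suffix letter. *)
  rewrite /splice => hr; case: ifP => // hlt.
  case: (graft_cases w i j c (w (r - i + j))) => [[z [h1 e1 ->]]|[_ n1]].
    apply/eqP; rewrite (same_at h) ?h1; try lia.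
    by rewrite -e1 [i + z]addnC addnK [z + j]addnC.
  by case: (n1 (r - i)); [lia | rewrite addnC].
by rewrite !E // (inj_eq (graft_inj h)).
Qed.

(** Fresh letters exceed all prefix letters, so a link across the seam must use a letter of the
    overlap. *)
Lemma splice_across w i j c p q : p < i -> i + c <= q ->
  splice w i j c p = splice w i j c q ->
  exists2 z, i <= z < i + c & splice w i j c p = splice w i j c z.
Proof.
move=> hp hq; rewrite splice_left; last lia.
rewrite /splice ifN; last lia.
case: (graft_cases w i j c (w (q - i + j))) => [[z [h1 e1 ->]]|[-> _]] e.
  by exists (i + z); [lia | rewrite ifT //; lia].
by have := @graft_bound w (i + c) p; lia.
Qed.

Lemma splice_same_left w i j c : same (i + c) (splice w i j c) 0 w 0.
Proof. by move=> x y hx hy; rewrite !add0n !splice_left. Qed.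

Lemma splice_same_right w i j c m : same c w i w j ->
  same m (splice w i j c) i w j.
Proof.
move=> h x y hx hy; rewrite splice_right //; try lia.
by rewrite ![i + _]addnC !addnK ![_ + j]addnC.
Qed.

(** The overlap has length [c >= b], so each window of length [b] lies entirely in the prefix or
    entirely in the suffix. *)
Lemma splice_local b A n w i j c : local_class b A -> b <= c ->
  A n w -> i + c <= n -> j + c <= n -> same c w i w j ->
  A (i + (n - j)) (splice w i j c).
Proof.
move=> hA bc An hi hj h; apply: (local_cover hA An) => [|k hk]; first lia.
have [le|gt] := leqP (k + b) (i + c).
  exists k; first lia.
  by have := @same_sub _ _ _ _ _ k b (@splice_same_left w i j c) le; rewrite !add0n.
exists (k - i + j); first lia.
have := @same_sub _ _ _ _ _ (k - i) b (@splice_same_right w i j c (k - i + b) h) (leqnn _).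
by rewrite [j + _]addnC (_ : i + (k - i) = k) //; lia.
Qed.

(** A window has at most [2 ^ (c * c)] equality patterns, one boolean for each pair of its
    positions. *)
Lemma window_pigeonhole c w s :
  exists i j, [/\ s <= i, i < j, j <= s + 2 ^ (c * c) & same c w i w j].
Proof.
pose T := {ffun 'I_c * 'I_c -> bool}.
pose f (p : 'I_(2 ^ (c * c)).+1) : T :=
  [ffun xy : 'I_c * 'I_c => w (s + p + xy.1) == w (s + p + xy.2)].
have /injectivePn[p [q neq eqf]] : ~~ injectiveb f.
  apply/negP => /injectiveP /leq_card.
  by rewrite card_ffun card_prod card_bool !card_ord ltnn.
have E x y : x < c -> y < c ->
    (w (s + p + x) == w (s + p + y)) = (w (s + q + x) == w (s + q + y)).
  move=> hx hy; have := congr1 (fun g : T => g (Ordinal hx, Ordinal hy)) eqf.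
  by rewrite !ffunE.
have := ltn_ord p; have := ltn_ord q.
have {neq} : (p : nat) <> q by move/val_inj/eqP; rewrite (negPf neq).
case: (ltnP p q) => [lt|gt] ? ? ?.
  by exists (s + p), (s + q); split; try lia.
exists (s + q), (s + p); split; try lia.
by move=> x y hx hy; rewrite E.
Qed.

Lemma local_kernel b A n w u : local_class b A -> same n u 0 w 0 ->
  A n w -> A n u.
Proof. by move=> hA h; apply: (local_occurs hA); exists 0. Qed.

Lemma local_factor b A n w k m : local_class b A -> k + m <= n ->
  A n w -> A m (fun x => w (k + x)).
Proof. by move=> hA h; apply: (local_occurs hA); exists k. Qed.

(** * In-out words *)

(** Only pairs at distance less than [c] are tested for periodicity: once gaps are short, they
    determine all other links. *)
Definition breaks c (w : nat -> nat) s e q := exists x y,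
  [/\ s <= x, x <= y < x + c, y + q < e &
      (w x == w y) <> (w (x + q) == w (y + q))].

Definition periodic c (w : nat -> nat) s e q := forall x y,
  s <= x -> x <= y < x + c -> y + q < e ->
  (w x == w y) = (w (x + q) == w (y + q)).

Lemma periodicVbreaks c w s e q : periodic c w s e q \/ breaks c w s e q.
Proof.
have [|h] := classic (breaks c w s e q); [by right | left=> x y hs hxy he].
by apply: NNPP => neq; apply: h; exists x, y.
Qed.

Lemma periodic_breaks c w s e q : periodic c w s e q -> ~ breaks c w s e q.
Proof. by move=> h [x [y [hs hxy he]]]; apply; apply: h. Qed.

Lemma breaks_same c w s e q u s' d :
  same d w s u s' -> s + d = e -> breaks c w s e q -> breaks c u s' (s' + d) q.
Proof.
move=> h <- [x [y [hs hxy he neq]]].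
exists (x - s + s'), (y - s + s'); split; try lia.
rewrite (same_at h) in neq; try lia.
rewrite (same_at (p := x + q) h) in neq; try lia.
have -> : x - s + s' + q = x + q - s + s' by lia.
by have -> : y - s + s' + q = y + q - s + s' by lia.
Qed.

Lemma breaks_widen c w s e q s' e' : s' <= s -> e <= e' ->
  breaks c w s e q -> breaks c w s' e' q.
Proof. by move=> hs he [x [y [? ? ? ?]]]; exists x, y; split=> //; lia. Qed.

(** The equal windows make the core from [i] to [i + q + c] locally [q]-periodic; the two breaks say
    that this fails when the core is extended to either end of the word. *)
Definition inout (A : nat -> (nat -> nat) -> Prop) c n w i q :=
  [/\ A n w, 0 < q, i + q + c <= n, same c w i w (i + q) &
      breaks c w 0 (i + q + c) q /\ breaks c w i n q].

Definition pump i q c k (w : nat -> nat) :=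
  iter k (fun u => splice u (i + q) i c) w.

(** Repeating the piece between the windows leaves the prefix intact, moves the suffix by [k * q]
    and lengthens the periodic core. The two equal windows survive, so the step can be iterated. *)
Lemma inout_pump b A c n w i q k : local_class b A -> b <= c ->
  inout A c n w i q -> let W := pump i q c k w in
  [/\ A (n + k * q) W, same c W i W (i + q), same (i + q + c) W 0 w 0,
      forall m, same m W (i + k * q) w i &
      periodic c W i (i + q + c + k * q) q].
Proof.
move=> hA bc [An q0 hn hs _]; elim: k => [|k].
  rewrite mul0n !addn0; split=> // x y hx hxy he.
  have -> : x = i + (x - i) by lia.
  have -> : y = i + (y - i) by lia.
  by rewrite hs; try lia; rewrite ![i + _ + q]addnAC.
rewrite [pump _ _ _ k.+1 w]/=; set W := pump _ _ _ k w => -[AW sW pW rW perW].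
have sW' := same_sym sW.
have R p r : i + q <= p -> i + q <= r ->
    (splice W (i + q) i c p == splice W (i + q) i c r)
    = (W (p - q) == W (r - q)).
  move=> hp hr; rewrite splice_right //.
  by have [-> ->] : p - (i + q) + i = p - q /\ r - (i + q) + i = r - q by lia.
have L p : p < i + q + c -> splice W (i + q) i c p = W p.
  by move=> hp; rewrite splice_left.
split.
- have -> : n + k.+1 * q = i + q + (n + k * q - i) by lia.
  by apply: (splice_local hA) => //; lia.
- move=> x y hx hy; rewrite (R (i + q + x)); try lia.
  have [-> ->] : i + q + x - q = i + x /\ i + q + y - q = i + y by lia.
  by rewrite !L; lia.
- by move=> x y hx hy; rewrite !add0n !L // -[x]add0n -[y]add0n pW.
- move=> m x y hx hy; rewrite R; try lia.
  have -> : i + k.+1 * q + x - q = i + k * q + x by lia.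
  have -> : i + k.+1 * q + y - q = i + k * q + y by lia.
  exact: rW hx hy.
move=> x y hx hxy hy; rewrite (R (x + q)); try lia; rewrite !addnK.
(* Before the end of the overlap the new word agrees with [W]; beyond it, the pair is read one
   period earlier, where [W] is periodic. *)
have [lt|ge] := ltnP y (i + q + c).
  by rewrite !L //; lia.
rewrite R; try lia; rewrite perW; try lia.
by rewrite !subnK //; lia.
Qed.

(** If a pumped word occurs at offset [t] in a longer one, then for [t < i] its right break, and for
    [t >= i] its left break, falls inside the periodic core of the longer word. *)
Lemma inout_antichain b A c n w i q : local_class b A -> b <= c ->
  inout A c n w i q -> exists u : nat -> nat * (nat -> nat),
  (forall k, A (u k).1 (u k).2) /\
  (forall k l, k <> l -> ~ occurs (u k).1 (u k).2 (u l).1 (u l).2).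
Proof.
move=> hA bc io; have P k := inout_pump k hA bc io.
exists (fun k => (n + k * n * q, pump i q c (k * n) w)); split=> [k|k l neq] /=.
  by have [] := P (k * n).
have [_ q0 hn _ [bl br]] := io.
have [_ _ pk rk _] := P (k * n); have [_ _ _ _ perl] := P (l * n).
move: (pump _ _ _ _ _) (pump _ _ _ _ _) pk rk perl => wl wk pk rk perl [t ht hs].
have n0 : 0 < n by lia.
have kl : k < l.
  by have := @leq_pmul2r (n * q) k l; rewrite muln_gt0 n0 q0 !mulnA; lia.
(* Pumping in multiples of [n] gives this room, so that the moved right break ends before the core
   of [wl] does. *)
have gap : k * n * q + n <= l * n * q.
  by rewrite -!mulnA (leq_trans _ (leq_mul kl (leqnn _))) // mulSn; nia.
have [ti|it] := ltnP t i; apply: (periodic_breaks perl).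
  have h : same (n - i) wl (t + (i + k * n * q)) w i.
    apply: (same_trans _ (rk _)); apply: same_sym.
    by have := same_sub (d := i + k * n * q) (m := n - i) hs; rewrite add0n; apply; lia.
  have := breaks_same (same_sym h) _ br.
  by move/(_ _)/breaks_widen; apply; lia.
have h : same (i + q + c) wl t w 0.
  apply: (same_trans _ pk); apply: same_sym.
  by have := same_sub (d := 0) (m := i + q + c) hs; rewrite !addn0; apply; lia.
have := breaks_same (same_sym h) _ bl.
by move/(_ _)/breaks_widen; apply; lia.
Qed.

Lemma breaks_agree c w s e q u d :
  (forall x y, s <= x < e -> s <= y < e ->
     (w x == w y) = (u (x + d) == u (y + d))) ->
  breaks c w s e q -> breaks c u (s + d) (e + d) q.
Proof.
move=> h [x [y [hs hxy he neq]]]; exists (x + d), (y + d); split; try lia.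
by rewrite h ?(h (x + q)) in neq; try lia; rewrite ![_ + d + q]addnAC.
Qed.

(** Within the matching windows a pair and its shift agree, so the break must begin before [i]. *)
Lemma inout_left A c n w i q : inout A c n w i q ->
  exists x y, [/\ x < i, x <= y < x + c, y < i + c &
    (w x == w y) <> (w (x + q) == w (y + q))].
Proof.
move=> [_ _ _ hs [[x [y [_ hxy he neq]]] _]]; exists x, y; split=> //; last lia.
rewrite ltnNge; apply/negP => ix; apply: neq.
rewrite (same_at hs); try lia.
by have [-> ->] : x - i + (i + q) = x + q /\ y - i + (i + q) = y + q by lia.
Qed.

Lemma inout_right A c n w i q : inout A c n w i q ->
  exists x y, [/\ i <= x, x <= y < x + c, i + c <= y, y + q < n &
    (w x == w y) <> (w (x + q) == w (y + q))].
Proof.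
move=> [_ _ _ hs [_ [x [y [hx hxy he neq]]]]]; exists x, y; split=> //.
rewrite leqNgt; apply/negP => ix; apply: neq.
rewrite (same_at hs); try lia.
by have [-> ->] : x - i + (i + q) = x + q /\ y - i + (i + q) = y + q by lia.
Qed.

(* A shortest such word starts with its left break and ends with its right
   break; a window repeated between these and the pair at [i], [i + q] could be
   cut out. *)
Lemma inout_shrink b A c n w i q : local_class b A -> b <= c ->
  inout A c n w i q -> q <= 2 ^ (c * c) -> exists n' w' i',
  n' <= 5 * 2 ^ (c * c) + c /\ inout A c n' w' i' q.
Proof.
move=> hA bc + qN; set N := 2 ^ _ in qN *.
elim/ltn_ind: n w i => n IH w i io.
have [le|gt] := leqP n (5 * N + c); first by exists n, w, i.
have [x [y [xi xy yi bl]]] := inout_left io.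
have [x' [y' [ix' xy' iy' yn br]]] := inout_right io.
have [An q0 hn hs _] := io.
have [x0|x0] := posnP x; last first.
  apply: (IH n.-1 _ (fun z => w (1 + z)) i.-1); first lia.
  split=> //; [by apply: (local_factor hA) An; lia| lia | |split].
  - move=> a a' ha ha'.
    have E z : 1 + (i.-1 + z) = i + z by lia.
    have E' z : 1 + (i.-1 + q + z) = i + q + z by lia.
    by rewrite !E !E' hs.
  - exists x.-1, y.-1; split; try lia.
    have [-> ->] : 1 + x.-1 = x /\ 1 + y.-1 = y by lia.
    by have [-> ->] : 1 + (x.-1 + q) = x + q /\ 1 + (y.-1 + q) = y + q by lia.
  - exists x'.-1, y'.-1; split; try lia.
    have [-> ->] : 1 + x'.-1 = x' /\ 1 + y'.-1 = y' by lia.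
    by have [-> ->] : 1 + (x'.-1 + q) = x' + q /\ 1 + (y'.-1 + q) = y' + q by lia.
have [yn'|yn'] := ltnP (y' + q) n.-1.
  apply: (IH n.-1 _ w i); first lia.
  split=> //; [by apply: (@local_factor _ _ n w 0 _ hA) An; lia| lia | split].
    by exists x, y; split; try lia.
  by exists x', y'; split; try lia.
(* When there is room left of [i], the search for equal windows starts at [q]: as [x = 0], the left
   break and its shift lie below [q + c], in the untouched prefix. *)
have [iN|iN] := leqP (q + N) i.
  have [a [a' [qa aa' aN ss]]] := window_pigeonhole c w q; rewrite -/N in aN.
  pose d := a' - a.
  have R p r : a <= p -> a <= r ->
      (splice w a a' c p == splice w a a' c r) = (w (p + d) == w (r + d)).
    move=> hp hr; rewrite splice_right //.
    by have [-> ->] : p - a + a' = p + d /\ r - a + a' = r + d by lia.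
  apply: (IH (a + (n - a')) _ (splice w a a' c) (i - d)); first lia.
  split=> //; [by apply: (splice_local hA) => //; lia | lia | | split].
  - move=> z z' hz hz'; rewrite (R (i - d + z)) ?(R (i - d + q + z)); try lia.
    have E t : i - d + t + d = i + t by lia.
    have E' t : i - d + q + t + d = i + q + t by lia.
    by rewrite !E !E' hs.
  - exists x, y; split; try lia.
    by rewrite !splice_left //; lia.
  - exists (x' - d), (y' - d); split; try lia.
    have xd : d <= x' by lia. have yd : d <= y' by lia.
    rewrite (R (x' - d)) ?(R (x' - d + q)); try lia.
    by rewrite ![_ - d + q + d]addnAC !subnK.
(* Now [i < q + N], so [a' < 2 * q + 2 * N <= 4 * N], while [x' >= n - q - c] exceeds [4 * N]; this
   is the source of the bound [5 * N + c]. *)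
have [a [a' [ia aa' aN ss]]] := window_pigeonhole c w (i + q); rewrite -/N in aN.
pose d := a' - a.
have R p r : a <= p -> a <= r ->
    (splice w a a' c p == splice w a a' c r) = (w (p + d) == w (r + d)).
  move=> hp hr; rewrite splice_right //.
  by have [-> ->] : p - a + a' = p + d /\ r - a + a' = r + d by lia.
apply: (IH (a + (n - a')) _ (splice w a a' c) i); first lia.
split=> //; [by apply: (splice_local hA) => //; lia | lia | | split].
- by move=> z z' hz hz'; rewrite !splice_left ?hs //; lia.
- exists x, y; split; try lia.
  by rewrite !splice_left //; lia.
- exists (x' - d), (y' - d); split; try lia.
  have xd : d <= x' by lia. have yd : d <= y' by lia.
  rewrite (R (x' - d)) ?(R (x' - d + q)); try lia.
  by rewrite ![_ - d + q + d]addnAC !subnK.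
Qed.

(** * Links between distant positions *)

Definition lonely_ends n (w : nat -> nat) :=
  (forall x, 0 < x < n -> w x <> w 0) /\
  (forall x, x < n.-1 -> w x <> w n.-1).

(** A link from an end across the seam would pass through the overlap, and so already be a link from
    that end in [w]. *)
Lemma splice_lonely_ends b w n i j : same b w i w j ->
  0 < i -> 0 < j -> i + b < n -> j + b < n ->
  lonely_ends n w -> lonely_ends (i + (n - j)) (splice w i j b).
Proof.
move=> ss i0 j0 hi hj [l0 l1]; have R p r := @splice_right w i j b p r ss.
split=> x hx e.
  have [lt|ge] := ltnP x (i + b).
    by move: e; rewrite !splice_left; try lia; apply: l0; lia.
  have [z hz] := splice_across i0 ge (esym e).
  by rewrite !splice_left; try lia; apply/nesym/l0; lia.
set p := (i + (n - j)).-1 in hx e.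
have pE : p - i + j = n.-1 by lia.
have [lt|ge] := ltnP x i.
  have ge : i + b <= p by lia.
  have [z hz] := splice_across lt ge e.
  rewrite e => /esym/eqP; rewrite R ?pE; try lia.
  by move/eqP; apply: l1; lia.
by move/eqP: e; rewrite R ?pE; try lia; move/eqP; apply: l1; lia.
Qed.

(** A cut between equal windows starting in the range from 1 to [N + 1] removes at most [N] letters,
    so a word longer than [2 * N + b + 2] stays above the lower bound. *)
Lemma lonely_ends_shrink b A n w : local_class b A ->
  2 ^ (b * b) + b + 2 <= n -> A n w -> lonely_ends n w ->
  exists n' w', [/\ 2 ^ (b * b) + b + 2 <= n', n' <= 2 * 2 ^ (b * b) + b + 2,
    A n' w' & lonely_ends n' w'].
Proof.
move=> hA; set N := 2 ^ _; elim/ltn_ind: n w => n IH w Nn An lw.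
have [le|gt] := leqP n (2 * N + b + 2); first by exists n, w.
have [i [j [i0 ij jN ss]]] := window_pigeonhole b w 1; rewrite -/N in jN.
apply: (IH (i + (n - j)) _ (splice w i j b)); try lia.
  by apply: (splice_local hA) => //; lia.
by apply: splice_lonely_ends => //; lia.
Qed.

(** No window of length [b < n] contains both ends, and the letters of both ends occur nowhere else,
    so identifying them is invisible to windows. *)
Lemma link_lonely_ends b A n w : local_class b A -> b < n -> 0 < n ->
  A n w -> lonely_ends n w -> A n (fun x => if x == n.-1 then w 0 else w x).
Proof.
move=> hA bn n0 An [l0 l1]; apply: (local_cover hA An) => [|k hk]; first lia.
exists k => // x y hx hy.
have [k0|k0] := posnP k.
  by rewrite !ifN //; lia.
have z0 z : 0 < z < n -> (w 0 == w z) = false.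
  by move=> hz; apply/eqP => e; apply: (l0 z).
have z1 z : z < n.-1 -> (w n.-1 == w z) = false.
  by move=> hz; apply/eqP => e; apply: (l1 z).
case: (k + x =P n.-1) => ex; case: (k + y =P n.-1) => ey //.
- by rewrite ex ey !eqxx.
- by rewrite ex z0 ?z1 //; lia.
- by rewrite ey ![w (k + x) == _]eq_sym z0 ?z1 //; lia.
Qed.

(** The last invariant holds because a long link either crosses the seam, hence meets the overlap,
    or is a shifted copy of a link of the previous word. In [w] itself only the two ends are that
    far apart. *)
Lemma lonely_ends_pump b A n w i q k : local_class b A ->
  A n w -> lonely_ends n w -> 0 < i -> 0 < q -> i + q + b < n ->
  same b w i w (i + q) -> let W := pump i q b k w in
  [/\ A (n + k * q) W, lonely_ends (n + k * q) W, same b W i W (i + q) &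
    forall x y, x < y < n + k * q -> n.-1 <= y - x -> W x = W y ->
      exists2 z, x < z < y & W z = W x].
Proof.
move=> hA An lw i0 q0 hn ss; elim: k => [|k].
  rewrite mul0n !addn0; split=> // x y hxy hn' e; exfalso.
  have [x0 y0] : x = 0 /\ y = n.-1 by lia.
  move: e; rewrite x0 y0 => e; apply: (proj1 lw n.-1); first lia.
  exact: esym e.
rewrite [pump _ _ _ k.+1 w]/=; set W := pump _ _ _ k w => -[AW lW sW gW].
have sW' := same_sym sW.
have R p r : i + q <= p -> i + q <= r ->
    (splice W (i + q) i b p == splice W (i + q) i b r)
    = (W (p - q) == W (r - q)).
  move=> hp hr; rewrite splice_right //.
  by have [-> ->] : p - (i + q) + i = p - q /\ r - (i + q) + i = r - q by lia.
have L p : p < i + q + b -> splice W (i + q) i b p = W p.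
  by move=> hp; rewrite splice_left.
have nE : n + k.+1 * q = i + q + (n + k * q - i) by lia.
split.
- by rewrite nE; apply: (splice_local hA) => //; lia.
- by rewrite nE; apply: splice_lonely_ends => //; lia.
- move=> x y hx hy; rewrite (R (i + q + x)); try lia.
  have [-> ->] : i + q + x - q = i + x /\ i + q + y - q = i + y by lia.
  by rewrite !L; lia.
move=> x y hxy hn' e.
have ge : i + q + b <= y by lia.
have [lt'|ge'] := ltnP x (i + q).
  have [z hz ez] := splice_across lt' ge e.
  by exists z => //; lia.
move/eqP: e; rewrite R; try lia; move/eqP => e.
have [z hz ez] := gW (x - q) (y - q) (ltac:(lia)) (ltac:(lia)) e.
exists (z + q); first lia.
by apply/eqP; rewrite R; try lia; rewrite addnK ez.
Qed.

(** Pump, then link the ends. If such a word occurs in a longer one at [t], its linked ends land on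
    [t] and [t + m]. Either [t + m] is the last position and the first letter recurs at [t > 0], or
    an equal letter lies strictly between; both contradict loneliness. *)
Lemma lonely_ends_antichain b A n w : local_class b A ->
  2 ^ (b * b) + b + 2 <= n -> A n w -> lonely_ends n w ->
  exists u : nat -> nat * (nat -> nat),
  (forall k, A (u k).1 (u k).2) /\
  (forall k l, k <> l -> ~ occurs (u k).1 (u k).2 (u l).1 (u l).2).
Proof.
move=> hA Nn An lw.
(* The lower bound on [n] keeps both windows strictly between the two end positions. *)
have [i [j [i0 ij jN ss]]] := window_pigeonhole b w 1.
pose q := j - i; have q0 : 0 < q by lia.
have jE : j = i + q by lia.
rewrite jE in ss jN.
have P k := @lonely_ends_pump b A n w i q k hA An lw i0 q0 (ltac:(lia)) ss.
exists (fun k => (n + k * q,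
  fun x => if x == (n + k * q).-1 then pump i q b k w 0 else pump i q b k w x)).
split=> [k|k l neq] /=.
  by have [Ak lk _ _] := P k; apply: (link_lonely_ends hA) => //; lia.
have [_ [lk _] _ _] := P k; have [_ [ll0 _] _ gl] := P l.
move: (pump i q b k w) (pump i q b l w) lk ll0 gl => U V lk ll0 gl [t ht hs].
have kl : k < l.
  by have := @leq_pmul2r q k l; rewrite q0; lia.
have kql : k * q < l * q by rewrite ltn_pmul2r.
have [m mE] : exists m, m = (n + k * q).-1 by exists (n + k * q).-1.
rewrite -mE in hs lk.
have m0 : (0 == m) = false by lia.
have tl : (t == (n + l * q).-1) = false by lia.
have e := hs 0 m (ltac:(lia)) (ltac:(lia)).
rewrite !add0n eqxx m0 eqxx addn0 tl in e; move/esym/eqP: e.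
case: eqP => [tm|tm] e.
  by apply: (ll0 t); [lia | exact: e].
have [z hz ez] := gl t (t + m) (ltac:(lia)) (ltac:(lia)) e.
have := hs 0 (z - t) (ltac:(lia)) (ltac:(lia)).
rewrite !add0n addn0 (_ : t + (z - t) = z); last lia.
rewrite !ifN; try lia.
rewrite ez eqxx => /eqP e'.
by apply: (lk (z - t)); [lia | rewrite e'].
Qed.

(** * Absence of both kinds of words implies comparability *)

Definition infinitely_many (P : nat -> Prop) := forall n, exists2 m, n <= m & P m.

Lemma infinitely_manyN P : ~ infinitely_many P ->
  exists n, forall m, n <= m -> ~ P m.
Proof.
move=> h; apply: NNPP => hN; apply: h => n; apply: NNPP => hn; apply: hN.
by exists n => m le Pm; apply: hn; exists m.
Qed.

Lemma infinitely_manyU P Q : infinitely_many (fun n => P n \/ Q n) ->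
  infinitely_many P \/ infinitely_many Q.
Proof.
move=> h; have [|/infinitely_manyN[n hn]] := classic (infinitely_many P).
  by left.
right=> m; have [k le [Pk|Qk]] := h (maxn n m); last by exists k => //; lia.
by case: (hn k) => //; lia.
Qed.

(** Were every colour used finitely often, no colour of [enum T] would be left beyond some bound. *)
Lemma infinitely_many_fiber (T : finType) (f : nat -> T) P :
  infinitely_many P -> exists c, infinitely_many (fun n => P n /\ f n = c).
Proof.
move=> hP; apply: NNPP => hN.
have [n hn] : exists n, forall m, n <= m -> P m -> f m \notin enum T.
  elim: (enum T) => [|c s [n hn]]; first by exists 0.
  have [] := @infinitely_manyN (fun n => P n /\ f n = c).
    by move=> h; apply: hN; exists c.
  move=> n' hn'; exists (maxn n n') => m le Pm; rewrite inE negb_or hn ?andbT //; try lia.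
  by apply/eqP => fm; apply: (hn' m) => //; lia.
by have [m le Pm] := hP n; have := hn _ le Pm; rewrite mem_enum.
Qed.

Lemma nondecreasing_pair (P : nat -> Prop) (h : nat -> nat) :
  infinitely_many P -> exists k l, [/\ k < l, P k, P l & h k <= h l].
Proof.
move=> hP; have [k _ Pk] := hP 0.
move: {2}(h k) (leqnn (h k)) => v; elim/ltn_ind: v k Pk => v IH k Pk hk.
have [l kl Pl] := hP k.+1.
have [le|gt] := leqP (h k) (h l); first by exists k, l.
by apply: (IH (h l) _ l Pl) => //; lia.
Qed.

(** Fix [k] of a colour used infinitely often. Without a good pair, infinitely many later [l] of
    this colour have [g l < g k], or infinitely many have [h l < h k]. That coordinate is then
    constant on an infinite set, where the other has a nondecreasing pair. *)
Lemma dickson (T : finType) (f : nat -> T) (g h : nat -> nat) :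
  exists k l, [/\ k < l, f k = f l, g k <= g l & h k <= h l].
Proof.
have [c hc] := @infinitely_many_fiber T f (fun=> True) (fun n => ex_intro2 _ _ n (leqnn n) I).
have [k _ [_ fk]] := hc 0.
apply: NNPP => hN.
have key (g' h' : nat -> nat) : infinitely_many (fun l => f l = c /\ g' l < g' k) ->
    (forall k l, ~ [/\ k < l, f k = f l, g' k <= g' l & h' k <= h' l]) -> False.
  move=> hi bad.
  have [v hv] := infinitely_many_fiber (fun l => inord (g' l) : 'I_(g' k).+1) hi.
  have [k' [l' [lt [[fk' gk'] vk] [[fl' gl'] vl] le]]] := nondecreasing_pair h' hv.
  apply: (bad k' l'); split=> //; first by rewrite fk' fl'.
  have -> : g' k' = v by rewrite -vk inordK //; lia.
  by have -> : g' l' = v by rewrite -vl inordK //; lia.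
have /infinitely_manyU[hg|hh] : infinitely_many
    (fun l => (f l = c /\ g l < g k) \/ (f l = c /\ h l < h k)).
  move=> n; have [l le [_ fl]] := hc (maxn n k.+1); exists l; first lia.
  have [lg|gg] := ltnP (g l) (g k); first by left.
  have [lh|gh] := ltnP (h l) (h k); first by right.
  by exfalso; apply: hN; exists k, l; split=> //; [lia | rewrite fk].
- by apply: (key g h) hg _ => k' l' h'; apply: hN; exists k', l'.
- by apply: (key h g) hh _ => k' l' [? ? ? ?]; apply: hN; exists k', l'.
Qed.

Lemma classical_ex_max (P : nat -> Prop) n : P 0 -> (forall t, P t -> t <= n) ->
  exists2 t, P t & forall t', P t' -> t' <= t.
Proof.
elim: n => [|n IH] P0 hn; first by exists 0.
have [Pn|nPn] := classic (P n.+1); first by exists n.+1.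
apply: IH => // t Pt; have := hn t Pt; rewrite leq_eqVlt ltnS => /orP[/eqP e|//].
by case: nPn; rewrite -e.
Qed.

(** Consecutive members of a class are then less than [c] apart, so short links generate all
    links. *)
Definition short_gaps c n (w : nat -> nat) := forall x y, x < y < n ->
  c <= y - x -> w x = w y -> exists2 z, x < z < y & w z = w x.

(** The factor spanning a gap of length at least [c] has its end letters linked only to each other.
    Making the first letter fresh is invisible to windows of length [b] and leaves both ends
    lonely. *)
Lemma local_short_gaps b c A : local_class b A -> b <= c -> 0 < c ->
  (forall n w, c <= n -> A n w -> ~ lonely_ends n w) ->
  forall n w, A n w -> short_gaps c n w.
Proof.
move=> hA bc c0 nl n w An x y hxy hc e; apply: NNPP => hN.
have w0 z : x < z < y -> (w x == w z) = false.
  by move=> hz; apply/eqP => ez; apply: hN; exists z.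
pose m := (y - x).+1.
pose U z := if z is 0 then (\max_(k < n) w k).+1 else w (x + z).
have UE z : 0 < z -> U z = w (x + z) by case: z.
have U0 z : 0 < z -> x + z < n -> (U 0 == U z) = false.
  by case: z => // z _ hz; have /= := graft_bound w hz; lia.
apply: (nl m U); first by rewrite /m; lia.
  have Am : A m (fun z => w (x + z)) by apply: (local_factor hA) An; lia.
  apply: (local_cover hA Am) => [|k hk]; first lia.
  exists k => // p q hp hq.
  have [k0|k0] := posnP k; last by rewrite !UE //; lia.
  rewrite k0 !add0n.
  case: p q hp hq => [|p] [|q] hp hq; rewrite ?eqxx //.
    by rewrite U0 ?addn0 ?w0 //; lia.
  by rewrite eq_sym U0 1?eq_sym ?addn0 ?w0 //; lia.
split=> z hz.
  by move/esym/eqP; rewrite U0 //; lia.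
rewrite (UE m.-1) ?[m.-1]/=; try lia.
rewrite (_ : x + (y - x) = y); last lia.
case: (posnP z) => [z0|z0]; last first.
  by rewrite UE // -e => /esym/eqP; rewrite w0 //; lia.
by rewrite z0 /= => e0; have yn : y < n by [lia]; have := graft_bound w yn; rewrite e0 ltnn.
Qed.

(** Induction on the distance: a long link of either word splits at an intermediate equal letter
    into two shorter links, which the other word shares. *)
Lemma occurs_of_agree c n w m u d : short_gaps c n w -> short_gaps c m u ->
  d + n <= m ->
  (forall x y, x <= y < x + c -> y < n ->
     (w x == w y) = (u (x + d) == u (y + d))) ->
  occurs n w m u.
Proof.
move=> gw gu hd h; exists d => //.
suff H v : forall x y, x <= y -> y - x = v -> y < n ->
    (w x == w y) = (u (x + d) == u (y + d)).
  move=> x y hx hy; rewrite !add0n ![d + _]addnC.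
  have [le|/ltnW le] := leqP x y; first exact: (H (y - x)).
  by rewrite eq_sym (H (x - y)) // eq_sym.
elim/ltn_ind: v => v IH x y xy vE hy.
have [lt|ge] := ltnP v c; first by apply: h => //; lia.
have [ve|v0] := posnP v; first by have -> : x = y by [lia]; rewrite !eqxx.
have split z : x < z < y -> (w x == w z) = (u (x + d) == u (z + d)) /\
    (w z == w y) = (u (z + d) == u (y + d)).
  by move=> hz; split; apply: (IH _ _ _ _ _ erefl); lia.
apply/eqP/eqP => e.
  have [z hz ez] := gw x y (ltac:(lia)) (ltac:(lia)) e.
  have [] := split z hz; rewrite ez e eqxx => /esym/eqP -> /esym/eqP.
  exact.
have [z' hz ez] := gu (x + d) (y + d) (ltac:(lia)) (ltac:(lia)) e.
have [z zE] : exists z, z' = z + d by exists (z' - d); lia.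
rewrite zE in hz ez.
have [] := split z (ltac:(lia)); rewrite ez e eqxx => /eqP -> /eqP.
exact.
Qed.

(* Take [q] and [t] with [t] maximal; a window repeated just after [t] cannot
   extend the periodic prefix, so the whole suffix is periodic. *)
Lemma periodic_ends (A : nat -> (nat -> nat) -> Prop) c N n w :
  N = 2 ^ (c * c) ->
  A n w -> (forall i q, q <= N -> ~ inout A c n w i q) ->
  exists t i q q',
  [/\ t <= i <= n, i <= t + N + c, 0 < q <= N, 0 < q' <= N &
      periodic c w 0 t q /\ periodic c w i n q'].
Proof.
move=> NE An nio; have N0 : 0 < N by rewrite NE expn_gt0.
pose P t := exists q, [/\ t <= n, 0 < q <= N & periodic c w 0 t q].
have [||t [q [tn qN pt]] tmax] := @classical_ex_max P n.
- by exists 1; split=> // x y ? ?; rewrite ltn0.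
- by move=> t [q []].
(* When too little of the word remains, the periodic suffix is empty: [i = n], with the arbitrary
   period 1. *)
have [lt|ge] := ltnP n (t + N + c).
  by exists t, n, q, 1; split; try lia; split=> // x y; lia.
have [i [j [ti ij jN ss]]] := window_pigeonhole c w t; rewrite -NE in jN.
exists t, i, q, (j - i); split; try lia; split=> //.
have jE : i + (j - i) = j by lia.
have [//|br] := periodicVbreaks c w i n (j - i).
have [p|bl] := periodicVbreaks c w 0 (j + c) (j - i).
  have : j + c <= t by apply: tmax; exists (j - i); split=> //; lia.
  by case: br => x [y [? ? ? ?]]; lia.
case: (nio i (j - i)); first lia.
by split; rewrite ?jE //; lia.
Qed.

(* Only the middle part has to be compared: [t - S] is truncated, but equality
   of the two values [minn t S] forces [t1 = t2] when this happens. *)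
Lemma periodic_occurs c S w1 n1 t1 i1 w2 n2 t2 i2 q q' :
  t1 <= i1 <= n1 -> t2 <= i2 <= n2 -> 0 < q -> 0 < q' -> q + c <= S -> q' + c <= S ->
  periodic c w1 0 t1 q -> periodic c w1 i1 n1 q' ->
  periodic c w2 0 t2 q -> periodic c w2 i2 n2 q' ->
  i1 - t1 = i2 - t2 -> minn t1 S = minn t2 S ->
  minn (n1 - i1) S = minn (n2 - i2) S ->
  same (2 * S + (i1 - t1)) w1 (t1 - S) w2 (t2 - S) ->
  t1 <= t2 -> n1 - i1 <= n2 - i2 ->
  forall x y, x <= y < x + c -> y < n1 ->
    (w1 x == w1 y) = (w2 (x + (t2 - t1)) == w2 (y + (t2 - t1))).
Proof.
move=> h1 h2 q0 q0' qS qS' pl1 pr1 pl2 pr2 em et er hs ht hr.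
have right y : forall x, t1 - S <= x -> x <= y < x + c -> y < n1 ->
    (w1 x == w1 y) = (w2 (x + (t2 - t1)) == w2 (y + (t2 - t1))).
  elim/ltn_ind: y => y IH x hx hxy hy.
  (* Pairs ending before [i1 + S] lie in the compared middle part; later ones move back by the
     period [q']. *)
  have [lt|ge] := ltnP y (i1 + S).
    rewrite (same_at hs); try lia.
    have -> : x - (t1 - S) + (t2 - S) = x + (t2 - t1) by lia.
    by have -> : y - (t1 - S) + (t2 - S) = y + (t2 - t1) by lia.
  have xq : q' <= x by lia.
  have yq : q' <= y by lia.
  have := pr1 (x - q') (y - q'); rewrite !subnK // => <-; try lia.
  have := pr2 (x + (t2 - t1) - q') (y + (t2 - t1) - q').
  rewrite !subnK; try lia; move=> <-; try lia.
  rewrite IH; try lia.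
  have -> : x - q' + (t2 - t1) = x + (t2 - t1) - q' by lia.
  by have -> : y - q' + (t2 - t1) = y + (t2 - t1) - q' by lia.
(* Pairs starting left of the middle part move right by the period [q], so [t1 - x] decreases. *)
move=> x; have [v vE] : exists v, v = t1 - x by exists (t1 - x).
elim/ltn_ind: v x vE => v IH x vE y hxy hy.
have [le|gt] := leqP (t1 - S) x; first exact: right.
rewrite pl1 // ?(pl2 (x + _)); try lia.
rewrite (IH (t1 - (x + q))) //; try lia.
by rewrite ![_ + q + _]addnAC.
Qed.

(** Apart from the lengths of its periodic prefix and suffix, a word is described by data from a
    finite set: the periods, the truncated lengths, and the length and kernel of the middle.
    Dickson's lemma with this colour finds the pair. *)
Lemma occurs_pair b A : local_class b A ->
  let c := 2 ^ (b * b) + b + 2 in let N := 2 ^ (c * c) in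
  (forall n w, c <= n -> A n w -> ~ lonely_ends n w) ->
  (forall n w i q, q <= N -> ~ inout A c n w i q) ->
  forall u : nat -> nat * (nat -> nat), (forall k, A (u k).1 (u k).2) ->
  exists k l, k < l /\ occurs (u k).1 (u k).2 (u l).1 (u l).2.
Proof.
move=> hA c N nl nio u Au.
have [bc c0] : b <= c /\ 0 < c by rewrite /c; lia.
have gaps := local_short_gaps hA bc c0 nl.
have /functional_choice[F hF] : forall k, exists d : nat * nat * (nat * nat),
  let: (t, i, (q, q')) := d in let: (n, w) := u k in
  [/\ t <= i <= n, i <= t + N + c, 0 < q <= N, 0 < q' <= N &
      periodic c w 0 t q /\ periodic c w i n q'].
  move=> k; case: (u k) (Au k) => n w /= An.
  have [t [i [q [q' h]]]] := periodic_ends erefl An (nio n w).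
  by exists (t, i, (q, q')).
(* [S] exceeds any period by [c], as [periodic_occurs] needs; [L] covers a margin [S] on each side
   of a middle of length at most [N + c]. *)
pose S := N + c; pose L := 2 * S + (N + c).
pose T k := (F k).1.1; pose I k := (F k).1.2.
pose R k := (u k).1 - I k.
pose f k := (inord (F k).2.1 : 'I_N.+1, inord (F k).2.2 : 'I_N.+1,
  inord (I k - T k) : 'I_(N + c).+1,
  inord (minn (T k) S) : 'I_S.+1, inord (minn (R k) S) : 'I_S.+1,
  [ffun p : 'I_L * 'I_L =>
     (u k).2 (T k - S + p.1) == (u k).2 (T k - S + p.2)]).
have [k [l [kl ef eT eR]]] := dickson f T R.
exists k, l; split=> //.
move: (hF k) (hF l) ef eT eR (gaps _ _ (Au k)) (gaps _ _ (Au l)).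
rewrite /f /R /T /I; move: (F k) (F l) (u k) (u l).
move=> [[t1 i1] [q1 q1']] [[t2 i2] [q2 q2']] [n1 w1] [n2 w2] /=.
move=> [h1 hi1 hq1 hq1' [pl1 pr1]] [h2 hi2 hq2 hq2' [pl2 pr2]].
case=> e1 e2 e3 e4 e5 e6 hT hR g1 g2.
have inordI m x y : x <= m -> y <= m ->
    (inord x : 'I_m.+1) = inord y -> x = y.
  by move=> ? ? /(congr1 val); rewrite /= !inordK.
have E1 : q1 = q2 by apply: inordI e1; lia.
have E2 : q1' = q2' by apply: inordI e2; lia.
have E3 : i1 - t1 = i2 - t2 by apply: inordI e3; lia.
have E4 : minn t1 S = minn t2 S by apply: inordI e4; apply: geq_minr.
have E5 : minn (n1 - i1) S = minn (n2 - i2) S by apply: inordI e5; apply: geq_minr.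
have E6 : same L w1 (t1 - S) w2 (t2 - S).
  move=> x y hx hy.
  have := congr1 (fun g : {ffun 'I_L * 'I_L -> bool} => g (Ordinal hx, Ordinal hy)) e6.
  by rewrite !ffunE.
rewrite -E1 -E2 in pl2 pr2.
apply: (occurs_of_agree g1 g2 (d := t2 - t1)); first lia.
apply: (periodic_occurs (S := S) _ _ _ _ _ _ pl1 pr1 pl2 pr2) => //; try lia.
by have := same_sub (d := 0) (m := 2 * S + (i1 - t1)) E6; rewrite !addn0; apply; lia.
Qed.

(** * Equivalence relations as kernels of words *)

Lemma occurs_trans m u n w l v :
  occurs m u n w -> occurs n w l v -> occurs m u l v.
Proof.
move=> [k hk hs] [k' hk' hs']; exists (k' + k); first lia.
by apply: (same_trans hs); apply: (same_sub (i := 0) hs').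
Qed.

Definition word r := nth 0 (eqvrel_word r).

Lemma occursP r s :
  reflect (occurs (len r) (word r) (len s) (word s)) (r <= s)%O.
Proof.
apply: (iffP (cleP r s)) => [[f [k hk] hf]|[k hk hs]].
  have sm k' : (forall i, f i = k' + i :> nat) ->
      same (len r) (word r) 0 (word s) k'.
    move=> hk' x y hx hy; rewrite !add0n.
    have := hf (Ordinal hx) (Ordinal hy); rewrite !eqvrel_wordE.
    by rewrite /word !hk'.
  (* For the empty relation the offset [k] is unconstrained, so offset 0 is taken instead. *)
  have [r0|r0] := posnP (len r).
    by exists 0; [lia | move=> x y; rewrite r0].
  exists k; last exact: sm.
  have lt : (len r).-1 < len r by lia.
  by have := ltn_ord (f (Ordinal lt)); rewrite hk /=; lia.
have lt (i : 'I_(len r)) : k + i < len s by have := ltn_ord i; lia.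
exists (fun i => Ordinal (lt i)) => [|x y]; first by exists k.
by rewrite !eqvrel_wordE; apply: hs.
Qed.

Lemma kernel_is_equiv n (w : nat -> nat) :
  is_equiv [set p : 'I_n * 'I_n | w p.1 == w p.2].
Proof.
apply/and3P; split.
- by apply/forallP => x; rewrite inE.
- by apply/forallP => x; apply/forallP => y; rewrite !inE eq_sym; apply/implyP.
apply/forallP => x; apply/forallP => y; apply/forallP => z; rewrite !inE.
by apply/implyP => /eqP ->; apply/implyP.
Qed.

Definition kernel n (w : nat -> nat) : eqvrel :=
  @EqRel (Tagged (fun n => {set 'I_n * 'I_n}) [set p : 'I_n * 'I_n | w p.1 == w p.2])
    (kernel_is_equiv n w).

Lemma word_kernel n w : same n (word (kernel n w)) 0 w 0.
Proof.
move=> x y hx hy; rewrite !add0n.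
have := @eqvrel_wordE (kernel n w) (Ordinal hx) (Ordinal hy).
by rewrite -/(word _) /= inE => <-.
Qed.

Lemma occurs_kernel m u n w :
  occurs (len (kernel m u)) (word (kernel m u)) (len (kernel n w)) (word (kernel n w))
  <-> occurs m u n w.
Proof.
have h k v : occurs k (word (kernel k v)) k v by exists 0 => //; apply: word_kernel.
have h' k v : occurs k v k (word (kernel k v)).
  by exists 0 => //; apply/same_sym/word_kernel.
split=> o; first exact: occurs_trans (h' m u) (occurs_trans o (h n w)).
exact: occurs_trans (h m u) (occurs_trans o (h' n w)).
Qed.

Definition avoids (B : seq eqvrel) n w :=
  forall r, r \in B -> ~ occurs (len r) (word r) n w.

Lemma avoids_word B s : s \in Av B <-> avoids B (len s) (word s).
Proof.
rewrite inE; split=> [/allP h r rB /occursP|h]; first exact/negP/h.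
by apply/allP => r rB; apply/negP => /occursP; apply: h.
Qed.

Lemma avoids_occurs B m u n w : occurs m u n w -> avoids B n w -> avoids B m u.
Proof. by move=> o h r rB o'; apply: (h r rB); apply: occurs_trans o. Qed.

Lemma avoids_kernel B n w : kernel n w \in Av B <-> avoids B n w.
Proof.
have o := @word_kernel n w.
by rewrite avoids_word; split; apply: avoids_occurs; exists 0 => //; apply: same_sym.
Qed.

(** An occurrence of a basis element fits into one window of length [b]. *)
Lemma avoids_local b B : (forall r, r \in B -> len r <= b) ->
  local_class b (avoids B).
Proof.
move=> hb; split=> [m u n w|n w bn h r rB [k hk hs]]; first exact: avoids_occurs.
have rb := hb r rB.
(* The window starts at [k] unless it would then run past the end of the word. *)
pose k' := minn k (n - b).
apply: (h k' _ r rB); first lia.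
exists (k - k'); first lia.
move=> x y hx hy; rewrite hs // !addnA.
by have -> : k' + (k - k') = k by lia.
Qed.

(** At equal lengths the only offset is 0, which makes the relations equivalent in the order. Hence
    descending chains are finite. *)
Lemma lt_len (r s : eqvrel) : (r < s)%O -> len r < len s.
Proof.
rewrite Order.POrderTheory.lt_neqAle => /andP[ne /occursP[k hk hs]].
rewrite ltn_neqAle; apply/andP; split; last lia.
apply/negP => /eqP e; case/eqP: ne; apply: Order.POrderTheory.le_anti.
apply/andP; split; apply/occursP; first by exists k.
exists 0; first lia.
have k0 : k = 0 by lia.
by rewrite k0 e in hs; apply: same_sym.
Qed.

(** A word of either kind yields an infinite antichain. Conversely, shrinking extends the bounded
    absence of both kinds to all lengths, and then every sequence has a comparable pair. *)
Lemma wqo_Av b B (c := 2 ^ (b * b) + b + 2) (N := 2 ^ (c * c)) :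
  (forall r, r \in B -> len r <= b) ->
  wqo (Av B) <->
  ~ (exists n w, [/\ c <= n, n <= 2 * 2 ^ (b * b) + b + 2,
       avoids B n w & lonely_ends n w]) /\
  ~ (exists n w i q, [/\ n <= 5 * N + c, q <= N & inout (avoids B) c n w i q]).
Proof.
move=> hb; have hA := avoids_local hb.
have bc : b <= c by rewrite /c; lia.
have anti : (exists u : nat -> nat * (nat -> nat),
    (forall k, avoids B (u k).1 (u k).2) /\
    (forall k l, k <> l -> ~ occurs (u k).1 (u k).2 (u l).1 (u l).2)) ->
    ~ wqo (Av B).
  move=> [u [Au hu]] []; case.
  exists (fun k => kernel (u k).1 (u k).2); split=> [k|k l /eqP kl].
    exact/avoids_kernel.
  apply/negP; rewrite /Order.comparable => /orP[] /occursP/occurs_kernel; apply: hu => //.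
  exact: nesym.
split=> [hw|[nl nio]].
  split=> [[n [w [cn _ An lw]]]|[n [w [i [q [_ qN io]]]]]]; apply: anti hw.
    exact: lonely_ends_antichain hA cn An lw.
  exact: inout_antichain hA bc io.
split=> [[u [Au hu]]|[u [Au hu]]].
  have nl' n w : c <= n -> avoids B n w -> ~ lonely_ends n w.
    move=> cn An lw; have [n' [w' [? ? ? ?]]] := lonely_ends_shrink hA cn An lw.
    by apply: nl; exists n', w'.
  have nio' n w i q : q <= N -> ~ inout (avoids B) c n w i q.
    move=> qN io; have [n' [w' [i' [? ?]]]] := inout_shrink hA bc io qN.
    by apply: nio; exists n', w', i', q.
  have [k [l [kl o]]] := occurs_pair (u := fun k => (len (u k), word (u k))) hA nl' nio'
    (fun k => proj1 (avoids_word B (u k)) (Au k)).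
  have /negP := hu k l (ltac:(by rewrite neq_ltn kl)); apply.
  by rewrite /Order.comparable; apply/orP; left; apply/occursP.
have h k : len (u k) + k <= len (u 0).
  elim: k => [|k IH]; first by rewrite addn0.
  by have := lt_len (hu k); lia.
by have := h (len (u 0)).+1; lia.
Qed.

(** * Computable functions *)

(* The argument list is passed as an environment [nat -> nat], so that moving a
   term under a binder is the conversion [v i ~> w i.+1]. *)
Definition computable n (f : (nat -> nat) -> nat) :=
  exists p, forall v, size v = n -> meval p v (f (nth 0 v)).

Lemma computable_ext n f g : (forall v, f v = g v) ->
  computable n f -> computable n g.
Proof. by move=> fg [p hp]; exists p => v /hp; rewrite fg. Qed.

Lemma computable_var n i : i < n -> computable n (fun v => v i).
Proof. by move=> lt; exists (MProj i) => v vn; apply: meval_proj; rewrite vn. Qed.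

Lemma computable_const n c : computable n (fun=> c).
Proof.
elim: c => [|c [p hp]]; first by exists MZero => v _; apply: meval_zero.
exists (MComp MSucc [:: p]) => v vn.
by apply: (@meval_comp _ _ _ [:: c]) => // [[]|] //=; [move=> _; exact: hp | exact: meval_succ].
Qed.

Lemma computable_succ n a : computable n a -> computable n (fun v => (a v).+1).
Proof.
move=> [p hp]; exists (MComp MSucc [:: p]) => v vn.
apply: (@meval_comp _ _ _ [:: a (nth 0 v)]) => // [[]|] //=.
  by move=> _; apply: hp.
exact: meval_succ.
Qed.

Lemma computable_comp1 (F : nat -> nat) n a :
  computable 1 (fun v => F (v 0)) -> computable n a ->
  computable n (fun v => F (a v)).
Proof.
move=> [p hp] [q hq]; exists (MComp p [:: q]) => v vn.
apply: (@meval_comp _ _ _ [:: a (nth 0 v)]) => // [[]|] //=.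
  by move=> _; apply: hq.
exact: hp.
Qed.

Lemma computable_comp2 (F : nat -> nat -> nat) n a b :
  computable 2 (fun v => F (v 0) (v 1)) -> computable n a -> computable n b ->
  computable n (fun v => F (a v) (b v)).
Proof.
move=> [p hp] [q hq] [r hr]; exists (MComp p [:: q; r]) => v vn.
apply: (@meval_comp _ _ _ [:: a (nth 0 v); b (nth 0 v)]) => // [[|[]]|] //=.
- by move=> _; apply: hq.
- by move=> _; apply: hr.
exact: hp.
Qed.

Lemma computable_comp3 (F : nat -> nat -> nat -> nat) n a b c :
  computable 3 (fun v => F (v 0) (v 1) (v 2)) ->
  computable n a -> computable n b -> computable n c ->
  computable n (fun v => F (a v) (b v) (c v)).
Proof.
move=> [p hp] [q hq] [r hr] [s hs]; exists (MComp p [:: q; r; s]) => v vn.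
apply: (@meval_comp _ _ _ [:: a (nth 0 v); b (nth 0 v); c (nth 0 v)])
  => // [[|[|[]]]|] //=.
- by move=> _; apply: hq.
- by move=> _; apply: hr.
- by move=> _; apply: hs.
exact: hp.
Qed.

Lemma computable_comp5 (F : nat -> nat -> nat -> nat -> nat -> nat) n a b c d e :
  computable 5 (fun v => F (v 0) (v 1) (v 2) (v 3) (v 4)) ->
  computable n a -> computable n b -> computable n c ->
  computable n d -> computable n e ->
  computable n (fun v => F (a v) (b v) (c v) (d v) (e v)).
Proof.
move=> [p hp] [pa ha] [pb hb] [pc hc] [pd hd] [pe he].
exists (MComp p [:: pa; pb; pc; pd; pe]) => v vn.
apply: (@meval_comp _ _ _ [:: a (nth 0 v); b (nth 0 v); c (nth 0 v);
  d (nth 0 v); e (nth 0 v)]) => // [[|[|[|[|[]]]]]|] //=.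
- by move=> _; apply: ha.
- by move=> _; apply: hb.
- by move=> _; apply: hc.
- by move=> _; apply: hd.
- by move=> _; apply: he.
exact: hp.
Qed.

Lemma computable_iteri n k g a :
  computable n k -> computable n a ->
  computable n.+2 (fun w => g (w 0) (w 1) (fun i => w i.+2)) ->
  computable n (fun v => iteri (k v) (fun i y => g i y v) (a v)).
Proof.
move=> [pk hk] [pa ha] [pg hg].
exists (MComp (MRec pa pg) (pk :: [seq MProj i | i <- iota 0 n])) => v vn.
apply: (@meval_comp _ _ _ (k (nth 0 v) :: v)).
- by rewrite /= size_map size_iota vn.
- case=> [_|i] /=; first exact: hk.
  rewrite ltnS size_map size_iota => lt.
  rewrite (nth_map 0) ?size_iota // nth_iota //.
  by apply: meval_proj; rewrite vn.
elim: (k (nth 0 v)) => [|m IH] /=; first exact/meval_rec0/ha.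
by apply: meval_recS IH _; apply: (hg [:: m, _ & v]); rewrite /= vn.
Qed.

Lemma computable_add n a b : computable n a -> computable n b ->
  computable n (fun v => a v + b v).
Proof.
apply: computable_comp2.
apply: (@computable_ext _ (fun v => iteri (v 0) (fun _ y => y.+1) (v 1))).
  by move=> v; elim: (v 0) => //= m ->.
apply: (@computable_iteri 2 _ (fun _ y _ => y.+1)); try exact: computable_var.
by apply: computable_succ; apply: computable_var.
Qed.

Lemma computable_mul n a b : computable n a -> computable n b ->
  computable n (fun v => a v * b v).
Proof.
apply: computable_comp2.
apply: (@computable_ext _ (fun v => iteri (v 0) (fun _ y => v 1 + y) 0)).
  by move=> v; elim: (v 0) => //= m ->; rewrite mulSn.
apply: (@computable_iteri 2 _ (fun _ y v => v 1 + y)).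
- exact: computable_var.
- exact: computable_const.
- by apply: computable_add; apply: computable_var.
Qed.

Lemma computable_exp n a b : computable n a -> computable n b ->
  computable n (fun v => a v ^ b v).
Proof.
apply: computable_comp2.
apply: (@computable_ext _ (fun v => iteri (v 1) (fun _ y => v 0 * y) 1)).
  by move=> v; elim: (v 1) => //= m ->; rewrite expnS.
apply: (@computable_iteri 2 _ (fun _ y v => v 0 * y)).
- exact: computable_var.
- exact: computable_const.
- by apply: computable_mul; apply: computable_var.
Qed.

Lemma computable_pred n a : computable n a -> computable n (fun v => (a v).-1).
Proof.
apply: (@computable_comp1 predn).
apply: (@computable_ext _ (fun v => iteri (v 0) (fun i _ => i) 0)).
  by move=> v; case: (v 0).
apply: (@computable_iteri 1 _ (fun i _ _ => i)).
- exact: computable_var.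
- exact: computable_const.
- exact: computable_var.
Qed.

Lemma computable_sub n a b : computable n a -> computable n b ->
  computable n (fun v => a v - b v).
Proof.
apply: computable_comp2.
apply: (@computable_ext _ (fun v => iteri (v 1) (fun _ y => y.-1) (v 0))).
  by move=> v; elim: (v 1) => [|m /= ->]; rewrite ?subn0 // subnS.
apply: (@computable_iteri 2 _ (fun _ y _ => y.-1)); try exact: computable_var.
by apply: computable_pred; apply: computable_var.
Qed.

Lemma computable_eq0 n a : computable n a -> computable n (fun v => a v == 0).
Proof.
apply: (@computable_comp1 (fun x => x == 0)).
apply: (@computable_ext _ (fun v => iteri (v 0) (fun _ _ => 0) 1)).
  by move=> v; case: (v 0).
apply: (@computable_iteri 1 _ (fun _ _ _ => 0)); try exact: computable_const.
exact: computable_var.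
Qed.

Lemma computable_leq n a b : computable n a -> computable n b ->
  computable n (fun v => a v <= b v).
Proof. by move=> ha hb; apply: computable_eq0; apply: computable_sub. Qed.

Lemma computable_neg n (P : (nat -> nat) -> bool) :
  computable n (fun v => P v) -> computable n (fun v => ~~ P v).
Proof.
by move/computable_eq0; apply: computable_ext => v; case: (P v).
Qed.

Lemma computable_and n (P Q : (nat -> nat) -> bool) :
  computable n (fun v => P v) -> computable n (fun v => Q v) ->
  computable n (fun v => P v && Q v).
Proof.
by move=> hP /(computable_mul hP); apply: computable_ext => v; rewrite mulnb.
Qed.

Lemma computable_eq n a b : computable n a -> computable n b ->
  computable n (fun v => a v == b v).
Proof.
move=> ha hb; apply: (@computable_ext _ (fun v => (a v <= b v) && (b v <= a v))).
  by move=> v; rewrite -eqn_leq.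
by apply: computable_and; apply: computable_leq.
Qed.

Lemma computable_eqb n (P Q : (nat -> nat) -> bool) :
  computable n (fun v => P v) -> computable n (fun v => Q v) ->
  computable n (fun v => P v == Q v).
Proof.
by move=> hP /(computable_eq hP); apply: computable_ext => v; case: (P v); case: (Q v).
Qed.

Lemma computable_implies n (P Q : (nat -> nat) -> bool) :
  computable n (fun v => P v) -> computable n (fun v => Q v) ->
  computable n (fun v => P v ==> Q v).
Proof.
move=> hP hQ; apply: (@computable_ext _ (fun v => ~~ (P v && ~~ Q v))).
  by move=> v; case: (P v); case: (Q v).
by apply: computable_neg; apply: computable_and => //; apply: computable_neg.
Qed.

Lemma iotaSr k : iota 0 k.+1 = rcons (iota 0 k) k.
Proof. by rewrite -addn1 iotaD add0n cats1. Qed.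

(** Lets the body of a bounded quantifier ignore the accumulator of the recursion that evaluates
    it. *)
Lemma computable_skip n (f : nat -> (nat -> nat) -> nat) :
  computable n.+1 (fun w => f (w 0) (fun i => w i.+1)) ->
  computable n.+2 (fun w => f (w 0) (fun i => w i.+2)).
Proof.
move=> [p hp].
exists (MComp p (MProj 0 :: [seq MProj i.+2 | i <- iota 0 n])) => v.
case: v => [|x [|y v]] //= [vn].
apply: (@meval_comp _ _ _ (x :: v)).
- by rewrite /= size_map size_iota vn.
- case=> [_|i] /=; first exact: meval_proj.
  rewrite ltnS size_map size_iota => lt.
  rewrite (nth_map 0) ?size_iota // nth_iota // add0n.
  by apply: (@meval_proj i.+2); rewrite /= vn.
by apply: (hp (x :: v)); rewrite /= vn.
Qed.

Lemma computable_all n k (P : nat -> (nat -> nat) -> bool) : computable n k ->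
  computable n.+1 (fun w => P (w 0) (fun i => w i.+1)) ->
  computable n (fun v => all (fun i => P i v) (iota 0 (k v))).
Proof.
move=> hk hP.
apply: (@computable_ext _ (fun v => iteri (k v) (fun i y => y * P i v) 1)).
  move=> v; elim: (k v) => // m; rewrite iteriS => ->.
  by rewrite iotaSr all_rcons mulnb andbC.
apply: (@computable_iteri n k (fun i y v => y * P i v)) => //.
  exact: computable_const.
apply: computable_mul; first exact: computable_var.
exact: (@computable_skip n (fun i v => P i v)).
Qed.

Lemma computable_has n k (P : nat -> (nat -> nat) -> bool) : computable n k ->
  computable n.+1 (fun w => P (w 0) (fun i => w i.+1)) ->
  computable n (fun v => has (fun i => P i v) (iota 0 (k v))).
Proof.
move=> hk hP.
apply: (@computable_ext _ (fun v => ~~ all (fun i => ~~ P i v) (iota 0 (k v)))).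
  by move=> v; rewrite -has_predC; congr nat_of_bool; apply: eq_has => i /=; rewrite negbK.
apply: computable_neg; apply: (@computable_all n k (fun i v => ~~ P i v)) => //.
exact: computable_neg.
Qed.

Lemma computable_count n k (P : nat -> (nat -> nat) -> bool) : computable n k ->
  computable n.+1 (fun w => P (w 0) (fun i => w i.+1)) ->
  computable n (fun v => count (fun i => P i v) (iota 0 (k v))).
Proof.
move=> hk hP.
apply: (@computable_ext _ (fun v => iteri (k v) (fun i y => y + P i v) 0)).
  move=> v; elim: (k v) => // m; rewrite iteriS => ->.
  by rewrite iotaSr -cats1 count_cat /= addn0.
apply: (@computable_iteri n k (fun i y v => y + P i v)) => //.
  exact: computable_const.
apply: computable_add; first exact: computable_var.
exact: (@computable_skip n (fun i v => P i v)).
Qed.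

Lemma computable_iter n k (g : nat -> nat) a : computable n k ->
  computable 1 (fun v => g (v 0)) -> computable n a ->
  computable n (fun v => iter (k v) g (a v)).
Proof.
move=> hk hg ha.
apply: (@computable_ext _ (fun v => iteri (k v) (fun _ y => g y) (a v))).
  by move=> v; elim: (k v) => //= m ->.
apply: (@computable_iteri n k (fun _ y _ => g y)) => //.
by apply: (computable_comp1 hg); apply: computable_var.
Qed.

Ltac computable1 := lazy beta; first
  [ apply: computable_var; done
  | simple apply computable_const
  | simple apply computable_succ
  | simple apply computable_add
  | simple apply computable_mul
  | simple apply computable_exp
  | simple apply computable_pred
  | simple apply computable_sub
  | simple apply computable_leq
  | simple apply computable_neg
  | simple apply computable_and
  | simple apply computable_eq
  | simple apply computable_eqb
  | simple apply computable_implies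
  | simple apply computable_all
  | simple apply computable_has
  | simple apply computable_count
  | simple apply computable_iter ].

(** * Decoding sequences by bounded search *)

(** The code of [x :: s] is [2 ^ x] times the odd number [2 * CodeSeq.code s + 1], so the head is
    the 2-adic valuation, obtained by counting the powers of 2 that divide [e]. At [e = 0] it is 0,
    the default of [nth]. *)
Definition hd_code e :=
  count (fun i => has (fun m => e == 2 ^ i.+1 * m) (iota 0 e)) (iota 0 e).

(** With [e = 2 ^ h * (2 * m + 1)], the [i] counted are exactly those below [m]. *)
Definition tl_code e :=
  count (fun i => 2 ^ hd_code e * (i + i).+1 < e) (iota 0 e).

Definition nth_code e i := hd_code (iter i tl_code e).

Definition size_code e := count (fun i => iter i tl_code e != 0) (iota 0 e).

Lemma computable_hd_code n a : computable n a ->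
  computable n (fun v => hd_code (a v)).
Proof. apply: computable_comp1; rewrite /hd_code; do !computable1. Qed.

Lemma computable_tl_code n a : computable n a ->
  computable n (fun v => tl_code (a v)).
Proof.
apply: computable_comp1; rewrite /tl_code.
by do !first [simple apply computable_hd_code | computable1].
Qed.

(** * The criterion on codes *)

Lemma count_ltn_iota h e : count (fun i => i < h) (iota 0 e) = minn h e.
Proof.
elim: e => [|e IH]; first by rewrite minn0.
by rewrite iotaSr -cats1 count_cat IH /= addn0; case: ltnP => /=; lia.
Qed.

Lemma hd_code_exp h m : hd_code (2 ^ h * m.*2.+1) = h.
Proof.
set e := _ * _; have he : h < e.
  by rewrite -[h.+1]muln1 leq_mul // ltn_expl.
rewrite /hd_code -[RHS](minn_idPl (ltnW he)) -count_ltn_iota.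
apply: eq_count => i; apply/hasP/idP => [[k _ /eqP ek]|lt].
  rewrite ltnNge; apply/negP => hi.
  have : 2 ^ h * m.*2.+1 = 2 ^ h * (2 ^ (i.+1 - h) * k).
    by rewrite mulnA -expnD subnKC 1?leqW.
  have -> : i.+1 - h = (i - h).+1 by lia.
  move/eqP; rewrite eqn_pmul2l ?expn_gt0 // expnS -mulnA mul2n => /eqP.
  by move/(congr1 odd); rewrite /= !odd_double.
exists (2 ^ (h - i.+1) * m.*2.+1).
  rewrite mem_iota add0n /= /e ltn_pmul2r // ltn_exp2l //; lia.
by rewrite mulnA -expnD subnKC.
Qed.

Lemma tl_code_exp h m : tl_code (2 ^ h * m.*2.+1) = m.
Proof.
rewrite /tl_code hd_code_exp; set e := _ * _.
have me : m <= e by rewrite -[m]mul1n leq_mul ?expn_gt0 //; lia.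
rewrite -[RHS](minn_idPl me) -count_ltn_iota; apply: eq_count => i.
by rewrite /e ltn_pmul2l ?expn_gt0 //; lia.
Qed.

Lemma iter_tl_code s i :
  iter i tl_code (CodeSeq.code s) = CodeSeq.code (drop i s).
Proof.
elim: i s => [|i IH] [|x s] //.
  by rewrite iterSr (_ : tl_code _ = CodeSeq.code [::]) // IH.
by rewrite iterSr /= tl_code_exp IH.
Qed.

Lemma nth_codeE s i : nth_code (CodeSeq.code s) i = nth 0 s i.
Proof.
rewrite /nth_code iter_tl_code -[i in RHS]addn0 -nth_drop.
by case: (drop i s) => //= x t; apply: hd_code_exp.
Qed.

Lemma size_leq_code s : size s <= CodeSeq.code s.
Proof.
elim: s => //= x s IH; rewrite -[(size s).+1]mul1n leq_mul ?expn_gt0 //; lia.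
Qed.

Lemma code_eq0 s : (CodeSeq.code s == 0) = (s == [::]).
Proof. by case: s => //= x s; rewrite muln_eq0 expn_eq0. Qed.

Lemma size_codeE s : size_code (CodeSeq.code s) = size s.
Proof.
rewrite /size_code -[RHS](minn_idPl (size_leq_code s)) -count_ltn_iota.
apply: eq_count => i; rewrite iter_tl_code code_eq0 -size_eq0 size_drop subn_eq0.
by rewrite -ltnNge.
Qed.

Definition code_bound n := iter n (fun m => 2 ^ n * (m + m).+1) 0.

Lemma code_leq_bound n s : size s <= n -> all (fun x => x < n) s ->
  CodeSeq.code s <= code_bound n.
Proof.
(* The length bound [k] varies in the induction, while the letter bound [n] stays fixed. *)
rewrite /code_bound; move: {1 3}n => k.
elim: s k => [|x s IH] [|k] //= hs /andP[xn hn]; have le := IH k hs hn.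
by rewrite leq_mul // ?leq_exp2l ?(ltnW xn) //; lia.
Qed.

(** Replacing each letter by its first position gives letters below [n], so a search up to
    [code_bound n] meets every kernel. *)
Lemma code_kernel n w : exists2 e, e <= code_bound n & same n (nth_code e) 0 w 0.
Proof.
pose f x := find (fun y => w y == w x) (iota 0 n).
exists (CodeSeq.code [seq f x | x <- iota 0 n]).
  apply: code_leq_bound; first by rewrite size_map size_iota.
  apply/allP => v /mapP[x]; rewrite mem_iota => hx ->.
  rewrite /f -[X in _ < X](size_iota 0 n) -has_find; apply/hasP.
  by exists x; rewrite ?mem_iota.
move=> x y hx hy; rewrite !add0n !nth_codeE !(nth_map 0) ?size_iota // !nth_iota //.
rewrite !add0n; apply/eqP/eqP => [e|e]; last by rewrite /f e.
have H z : z < n -> w (f z) = w z.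
  move=> hz; have hs : has (fun y => w y == w z) (iota 0 n).
    by apply/hasP; exists z; rewrite ?mem_iota.
  have := nth_find 0 hs; rewrite nth_iota ?add0n => [/eqP //|].
  by rewrite -[X in _ < X](size_iota 0 n) -has_find.
by rewrite -H // e H.
Qed.

Lemma allP_iota (P : pred nat) n :
  reflect (forall i, i < n -> P i) (all P (iota 0 n)).
Proof.
apply: (iffP allP) => h i; last by rewrite mem_iota => /h.
by move=> hi; apply: h; rewrite mem_iota.
Qed.

Lemma hasP_iota (P : pred nat) n :
  reflect (exists2 i, i < n & P i) (has P (iota 0 n)).
Proof.
apply: (iffP hasP) => -[i hi Pi]; exists i => //.
  by rewrite mem_iota in hi.
by rewrite mem_iota.
Qed.

Definition same_code c w i u j := all (fun x => all (fun y =>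
  (nth_code w (i + x) == nth_code w (i + y)) ==
  (nth_code u (j + x) == nth_code u (j + y))) (iota 0 c)) (iota 0 c).

Definition occurs_code r n w := has (fun k =>
  (k + size_code r <= n) && same_code (size_code r) r 0 w k) (iota 0 n.+1).

Definition avoids_code e n w :=
  all (fun i => ~~ occurs_code (nth_code e i) n w) (iota 0 (size_code e)).

Definition lonely_ends_code n w :=
  all (fun x => (0 < x) ==> (nth_code w x != nth_code w 0)) (iota 0 n) &&
  all (fun x => nth_code w x != nth_code w n.-1) (iota 0 n.-1).

Definition breaks_code c w s e q := has (fun x => has (fun y =>
  [&& s <= x, x <= y, y < x + c, y + q < e &
    (nth_code w x == nth_code w y) !=
    (nth_code w (x + q) == nth_code w (y + q))]) (iota 0 e)) (iota 0 e).

Definition inout_code c n w i q :=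
  [&& 0 < q, i + q + c <= n, same_code c w i w (i + q),
      breaks_code c w 0 (i + q + c) q & breaks_code c w i n q].

(* The code of a basis exceeds the length of each of its members, so it serves
   as the window length. *)
Definition wqo_code e :=
  let N1 := 2 ^ (e * e) in
  let c := N1 + e + 2 in
  let N := 2 ^ (c * c) in
  ~~ has (fun n => has (fun w =>
       [&& c <= n, avoids_code e n w & lonely_ends_code n w])
       (iota 0 (code_bound n).+1)) (iota 0 (2 * N1 + e + 2).+1) &&
  ~~ has (fun n => has (fun w => avoids_code e n w && has (fun i => has (fun q =>
       inout_code c n w i q) (iota 0 N.+1)) (iota 0 n))
       (iota 0 (code_bound n).+1)) (iota 0 (5 * N + c).+1).

Lemma same_codeP c w i u j :
  reflect (same c (nth_code w) i (nth_code u) j) (same_code c w i u j).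
Proof.
apply: (iffP (allP_iota _ _)) => h x.
  by move=> y hx hy; have /allP_iota/(_ y hy)/eqP := h x hx.
by move=> hx; apply/allP_iota => y hy; apply/eqP/h.
Qed.

Lemma occurs_codeP r n w :
  reflect (occurs (len r) (word r) n (nth_code w))
    (occurs_code (CodeSeq.code (eqvrel_word r)) n w).
Proof.
have E k : same (len r) (nth_code (CodeSeq.code (eqvrel_word r))) 0 (nth_code w) k
    <-> same (len r) (word r) 0 (nth_code w) k.
  by split=> h x y hx hy; have := h x y hx hy; rewrite !nth_codeE.
rewrite /occurs_code size_codeE size_eqvrel_word.
apply: (iffP (hasP_iota _ _)) => [[k _ /andP[hk /same_codeP/E hs]]|[k hk hs]].
  by exists k.
by exists k; [lia | rewrite hk; apply/same_codeP/E].
Qed.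

Lemma avoids_codeP B n w :
  reflect (avoids B n (nth_code w)) (avoids_code (code_basis B) n w).
Proof.
have nthB i : i < size B -> exists2 r, r \in B &
    nth_code (code_basis B) i = CodeSeq.code (eqvrel_word r).
  case: B => // r0 B hi; exists (nth r0 (r0 :: B) i); first exact: mem_nth.
  by rewrite nth_codeE (nth_map r0).
rewrite /avoids_code size_codeE size_map.
apply: (iffP (allP_iota _ _)) => [h r rB|h i hi].
  have lt : index r B < size B by rewrite index_mem.
  have := h _ lt; rewrite nth_codeE (nth_map r) // nth_index //.
  by move/occurs_codeP.
by have [r rB ->] := nthB i hi; apply/occurs_codeP/h.
Qed.

Lemma lonely_ends_codeP n w :
  reflect (lonely_ends n (nth_code w)) (lonely_ends_code n w).
Proof.
apply: (iffP andP) => -[h1 h2].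
  split=> x hx; last by have /allP_iota/(_ x hx)/eqP := h2.
  have /andP[x0 xn] := hx.
  by have /allP_iota/(_ x xn)/implyP/(_ x0)/eqP := h1.
split; apply/allP_iota => x hx; last exact/eqP/h2.
by apply/implyP => x0; apply/eqP/h1; rewrite x0.
Qed.

Lemma breaks_codeP c w s e q :
  reflect (breaks c (nth_code w) s e q) (breaks_code c w s e q).
Proof.
apply: (iffP (hasP_iota _ _)).
  move=> [x hx /hasP_iota[y hy /and5P[h1 h2 h3 h4 /eqP h5]]].
  by exists x, y; split=> //; rewrite h2.
move=> [x [y [h1 /andP[h2 h3] h4 /eqP h5]]].
exists x; first lia; apply/hasP_iota; exists y; first lia.
exact/and5P.
Qed.

Lemma inout_codeP (A : nat -> (nat -> nat) -> Prop) c n w i q :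
  A n (nth_code w) ->
  reflect (inout A c n (nth_code w) i q) (inout_code c n w i q).
Proof.
move=> Aw; apply: (iffP and5P).
  move=> [h1 h2 /same_codeP h3 /breaks_codeP h4 /breaks_codeP h5].
  by split.
move=> [_ h1 h2 h3 [h4 h5]]; split=> //; first exact/same_codeP.
  exact/breaks_codeP.
exact/breaks_codeP.
Qed.

Lemma lonely_ends_same n w u : same n u 0 w 0 -> lonely_ends n w ->
  lonely_ends n u.
Proof.
move=> h [l0 l1]; split=> x hx /eqP; have := h x; rewrite !add0n => E.
  by have := E 0; rewrite !add0n => ->; try lia; move/eqP; apply: l0.
by have := E n.-1; rewrite !add0n => ->; try lia; move/eqP; apply: l1.
Qed.

Lemma inout_same b A c n w u i q : local_class b A -> same n u 0 w 0 ->
  inout A c n w i q -> inout A c n u i q.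
Proof.
move=> hA h [An q0 hn hs [bl br]]; have h' := same_sym h.
have E x y : x < n -> y < n -> (u x == u y) = (w x == w y) by apply: h.
split=> //; first exact: local_kernel hA h An.
  by move=> x y hx hy; rewrite !E; [exact: hs | lia..].
split.
  by have := breaks_agree (d := 0) (u := u) _ bl; rewrite !addn0; apply => x y hx hy;
    rewrite !addn0 E //; lia.
by have := breaks_agree (d := 0) (u := u) _ br; rewrite !addn0; apply => x y hx hy;
    rewrite !addn0 E //; lia.
Qed.

Lemma wqo_codeP B : wqo_code (code_basis B) <-> wqo (Av B).
Proof.
(* The length of a word is at most its code, which is less than the code of any list containing
   it. *)
have hb r : r \in B -> len r <= code_basis B.
  move=> rB; rewrite -size_eqvrel_word (leq_trans (size_leq_code _)) // ltnW //.
  have /allP := CodeSeq.ltn_code [seq CodeSeq.code (eqvrel_word r) | r <- B].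
  by apply; apply: map_f.
have hA := avoids_local hb.
rewrite (wqo_Av hb) /wqo_code; move: (code_basis B) (@avoids_codeP B) hA => e avP hA.
set N1 := 2 ^ (e * e); set c := N1 + e + 2; set N := 2 ^ (c * c).
split.
  move=> /andP[/negP h1 /negP h2]; split.
    move=> [n [w [cn nM An lw]]]; apply: h1; apply/hasP_iota; exists n => //.
    have [x hx hs] := code_kernel n w.
    apply/hasP_iota; exists x => //; apply/and3P; split=> //.
      by apply/avP; apply: local_kernel hA hs An.
    by apply/lonely_ends_codeP; apply: lonely_ends_same hs lw.
  move=> [n [w [i [q [nM qN io]]]]]; apply: h2; apply/hasP_iota; exists n => //.
  have [x hx hs] := code_kernel n w.
  have io' := inout_same hA hs io.
  have [Ax q0 hn _ _] := io'.
  apply/hasP_iota; exists x => //; apply/andP; split; first exact/avP.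
  apply/hasP_iota; exists i; first lia.
  by apply/hasP_iota; exists q => //; apply/(inout_codeP _ _ _ Ax).
move=> [h1 h2]; apply/andP; split; apply/negP.
  move=> /hasP_iota[n nM /hasP_iota[w _ /and3P[cn /avP An /lonely_ends_codeP lw]]].
  by apply: h1; exists n, (nth_code w).
move=> /hasP_iota[n nM /hasP_iota[w _ /andP[/avP An /hasP_iota[i _ /hasP_iota[q qN]]]]].
by move/(inout_codeP _ _ _ An) => io; apply: h2; exists n, (nth_code w), i, q.
Qed.

(** * Computability of the criterion *)

Lemma computable_nth_code n a b : computable n a -> computable n b ->
  computable n (fun v => nth_code (a v) (b v)).
Proof.
apply: computable_comp2; rewrite /nth_code.
by do !first [simple apply computable_hd_code | simple apply computable_tl_code | computable1].
Qed.

Lemma computable_size_code n a : computable n a ->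
  computable n (fun v => size_code (a v)).
Proof.
apply: computable_comp1; rewrite /size_code.
by do !first [simple apply computable_tl_code | computable1].
Qed.

Ltac computable2 := first
  [ simple apply computable_nth_code | simple apply computable_size_code
  | computable1 ].

Lemma computable_code_bound n a : computable n a ->
  computable n (fun v => code_bound (a v)).
Proof.
apply: computable_comp1.
apply: (@computable_ext _ (fun v => iteri (v 0) (fun _ m => 2 ^ v 0 * (m + m).+1) 0)).
  by move=> v; rewrite /code_bound; elim: {1 3}(v 0) => //= m ->.
by apply: (@computable_iteri 1 _ (fun _ m v => 2 ^ v 0 * (m + m).+1)); do !computable1.
Qed.

Lemma computable_same_code n a b c d e :
  computable n a -> computable n b -> computable n c -> computable n d ->
  computable n e -> computable n (fun v => same_code (a v) (b v) (c v) (d v) (e v)).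
Proof.
by apply: (computable_comp5 (F := same_code)); rewrite /same_code; do !computable2.
Qed.

Lemma computable_breaks_code n a b c d e :
  computable n a -> computable n b -> computable n c -> computable n d ->
  computable n e -> computable n (fun v => breaks_code (a v) (b v) (c v) (d v) (e v)).
Proof.
by apply: (computable_comp5 (F := breaks_code)); rewrite /breaks_code; do !computable2.
Qed.

Lemma computable_inout_code n a b c d e :
  computable n a -> computable n b -> computable n c -> computable n d ->
  computable n e -> computable n (fun v => inout_code (a v) (b v) (c v) (d v) (e v)).
Proof.
apply: (computable_comp5 (F := inout_code)); rewrite /inout_code.
by do !first [simple apply computable_same_code
  | simple apply computable_breaks_code | computable2].
Qed.

Lemma computable_occurs_code n a b c :
  computable n a -> computable n b -> computable n c ->
  computable n (fun v => occurs_code (a v) (b v) (c v)).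
Proof.
apply: (computable_comp3 (F := occurs_code)); rewrite /occurs_code.
by do !first [simple apply computable_same_code | computable2].
Qed.

Lemma computable_avoids_code n a b c :
  computable n a -> computable n b -> computable n c ->
  computable n (fun v => avoids_code (a v) (b v) (c v)).
Proof.
apply: (computable_comp3 (F := avoids_code)); rewrite /avoids_code.
by do !first [simple apply computable_occurs_code | computable2].
Qed.

Lemma computable_lonely_ends_code n a b :
  computable n a -> computable n b ->
  computable n (fun v => lonely_ends_code (a v) (b v)).
Proof.
apply: (computable_comp2 (F := lonely_ends_code)); rewrite /lonely_ends_code.
by do !computable2.
Qed.

Lemma computable_wqo_code : computable 1 (fun v => wqo_code (v 0)).
Proof.
rewrite /wqo_code.
by do !first [simple apply computable_avoids_code
  | simple apply computable_lonely_ends_code | simple apply computable_inout_code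
  | simple apply computable_code_bound | computable1].
Qed.

Theorem theorem9p4 : decidable_by_murec code_basis (fun B : seq eqvrel => wqo (Av B)).
Proof.
have [p hp] := computable_wqo_code; exists p => B.
by exists (wqo_code (code_basis B)); [apply: (hp [:: _]) | apply: wqo_codeP].
Qed.
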